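(* Let $M$ be a manifold with volume form $\omega$ and let $(P_1,P_2)$ be a matching of two $\omega$-modular bivectors on $M$ whose $\omega$-modular fields $\Xi_1,\Xi_2$ are independent and commute, such that the foliation generated by $\Xi_1,\Xi_2$ is a fibration $\pi:M\to N$, and let vector fields $\bar Z,\bar W$ on $N$ and functions $z,u,v\in C^\infty(N)$ be associated with it as described in the context. Then $\bar Z,\bar W,z,u,v$ are differential invariants of the matching with respect to the group of diffeomorphisms of $M$ preserving $\omega$; i.e. they depend only on the matching (not on the choices made in their construction), and a diffeomorphism preserving $\omega$ that carries one matching to another carries (via the induced diffeomorphism of the base) the data $(\bar Z,\bar W,z,u,v)$ of the first to those of the second.
   Context: An $\omega$-modular bivector is a bivector $X\wedge\Xi$, where $X,\Xi$ are vector fields on $M$ with $[X,\Xi]=0$, $L_\Xi(\omega)=0$, $L_X(\omega)=\omega$; it is a Poisson bivector, and $\Xi$ is its $\omega$-modular field (the field defined by $\Xi\rfloor\omega=d(P\rfloor\omega)$ for $P=X\wedge\Xi$, with $i_{X\wedge\Xi}=i_X\circ i_\Xi$). Two Poisson bivectors are compatible if their sum is a Poisson bivector. A matching here is an ordered pair of compatible $\omega$-modular bivectors $P_i=X_i\wedge\Xi_i$, $i=1,2$. It is assumed that $\Xi_1,\Xi_2$ are pointwise linearly independent and $[\Xi_1,\Xi_2]=0$. Compatibility then yields $[X_1,\Xi_2]=f_1\Xi_1+\lambda\Xi_2$, $[X_2,\Xi_1]=\lambda\Xi_1+f_2\Xi_2$, $[X_1,X_2]=\lambda(X_1-X_2)+\mu_1\Xi_1-\mu_2\Xi_2$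 for some functions $f_1,f_2,\lambda,\mu_1,\mu_2$. Locally, replacing $X_i$ by $X_i+g_i\Xi_i$ with suitable $g_i$, $\Xi_i(g_i)=0$, one achieves $f_1=f_2=0$; it is assumed that $X_1,X_2$ are normalised in this way. The setting is local: the $2$-dimensional foliation generated by $\Xi_1,\Xi_2$ is a fibration $\pi:M\to N$ (with connected fibres). Put $Z=X_1-X_2$, $W=X_1+X_2$. These fields are $\pi$-projectable; $\bar Z,\bar W$ denote their projections to $N$. Moreover $\lambda=\pi^*(z)$ and $\Xi_i(\mu_i)=\pi^*(\nu_i)$, $i=1,2$, for functions $z,\nu_1,\nu_2\in C^\infty(N)$; set $u=\nu_2-\nu_1$ and $v=\nu_1+\nu_2$. *)

(* Defs.v *)
From HB Require Import structures.
From mathcomp Require Import all_boot all_order all_algebra.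
From mathcomp Require Import all_classical all_reals interval_inference.
From mathcomp Require Import ring.
From mathcomp Require Import topology normedtype landau derive.

Set Implicit Arguments.
Unset Strict Implicit.
Unset Printing Implicit Defensive.

Import Order.TTheory GRing.Theory Num.Theory.
Import numFieldNormedType.Exports.

Local Open Scope classical_set_scope.
Local Open Scope ring_scope.

(* [Ck k U f]: on the open set U, f is of class C^k.  The recursion reads
   "f is differentiable and all its directional derivatives are C^(k-1)". *)
Fixpoint Ck (R : realType) (V W : normedModType R) (k : nat) (U : set V)
    (f : V -> W) : Prop :=
  match k with
  | 0 => forall x, U x -> {for x, continuous f}
  | k'.+1 => (forall x, U x -> differentiable f x) /\
             (forall v, Ck k' U (fun x => 'D_v f x))
  end.

Definition smooth_on (R : realType) (V W : normedModType R) (U : set V)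
    (f : V -> W) : Prop :=
  forall k, Ck k U f.

Section CkTheory.
Variables (R : realType) (V : normedModType R).
Implicit Types (U : set V) (f g : V -> R^o).

Lemma near_eq_differentiable (W : normedModType R) (f g : V -> W) (x : V) :
  {near x, f =1 g} -> differentiable f x -> differentiable g x.
Proof.
move=> fg df; have fgx : f x = g x := nbhs_singleton fg.
have dc : continuous ('d f x) by exact: diff_continuous.
have gE : g \o shift x = cst (g x) + 'd f x +o_ 0 id.
  apply/eqaddoP => _/posnumP[e].
  have /eqaddoP /(_ e%:num) /(_ [gt0 of e%:num]) := diff_locally df.
  have : \forall y \near 0, f (y + x) = g (y + x).
    by move: fg; rewrite (near_shift 0 x) /= subr0.
  apply: filterS2 => y /= fgy.
  by rewrite -[(_ - _) y]/(f (y + x) - (f x + 'd f x y))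
             -[in X in _ -> X]/(g (y + x) - (g x + 'd f x y)) fgy fgx.
by apply/diff_locallyP; rewrite (diff_unique dc gE).
Qed.

Lemma Ck_ext (W : normedModType R) k U (f g : V -> W) :
  open U -> (forall x, U x -> f x = g x) -> Ck k U f -> Ck k U g.
Proof.
move=> oU; elim: k f g => [|k IH] f g fg.
  move=> /= cf x Ux; have nfg : {near nbhs x, f =1 g}.
    by apply: filterS (open_nbhs_nbhs (conj oU Ux)).
  have cfx : f @ x --> f x := cf x Ux; rewrite fg // in cfx.
  by apply: cvg_trans cfx; apply: near_eq_cvg; apply: filterS nfg => y /= ->.
have nfg x : U x -> {near x, f =1 g}.
  by move=> Ux; apply: filterS (open_nbhs_nbhs (conj oU Ux)).
move=> [df Df]; split=> [x Ux|v].
  exact: near_eq_differentiable (nfg _ Ux) (df x Ux).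
by apply: IH (Df v) => x Ux; apply: near_eq_derive; exact: nfg.
Qed.

Lemma Ck_pred k U (f : V -> R^o) : Ck k.+1 U f -> Ck k U f.
Proof.
elim: k f => [|k IH] f [df Df] /=.
  by move=> x Ux; apply: differentiable_continuous; exact: df.
by split=> // v; apply: IH; exact: Df.
Qed.

Lemma Ck_cst k U (a : R) : Ck k U (fun=> a : R^o).
Proof.
elim: k a => [|k IH] a /=; first by move=> x _; exact: cst_continuous.
split=> [x _|v]; first exact: differentiable_cst.
have -> : 'D_v (fun=> a : R^o) = (fun=> 0) by apply/funext => x; exact: derive_cst.
exact: IH.
Qed.

Lemma CkD k U f g : open U -> Ck k U f -> Ck k U g -> Ck k U (f + g).
Proof.
move=> oU; elim: k f g => [|k IH] f g /=.
  by move=> cf cg x Ux; apply: continuousD; [exact: cf|exact: cg].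
move=> [df Df] [dg Dg]; split=> [x Ux|v].
  by apply: differentiableD; [exact: df|exact: dg].
apply: (Ck_ext oU _ (IH _ _ (Df v) (Dg v))) => x Ux.
by rewrite deriveD //; apply: diff_derivable; [exact: df|exact: dg].
Qed.

Lemma CkM k U f g :
  open U -> Ck k U f -> Ck k U g -> Ck k U (fun x => f x * g x : R^o).
Proof.
move=> oU; elim: k f g => [|k IH] f g.
  by move=> /= cf cg x Ux; apply: (@continuousM R); [exact: cf|exact: cg].
move=> kf kg; have [[df Df] [dg Dg]] := (kf, kg); split=> [x Ux|v].
  by apply: differentiableM; [exact: df|exact: dg].
apply: (Ck_ext oU _ (CkD oU (IH _ _ (Ck_pred kf) (Dg v))
                            (IH _ _ (Ck_pred kg) (Df v)))) => x Ux.
by rewrite deriveM //; apply: diff_derivable; [exact: df|exact: dg].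
Qed.

End CkTheory.

(* Only the values of [coord] on [dom] and of [coordV] on [coord @` dom]
   are meaningful. *)
Record chart (R : realType) (n : nat) (T : topologicalType) := Chart {
  dom : set T;
  coord : T -> 'rV[R]_n;
  coordV : 'rV[R]_n -> T;
  dom_open : open dom;
  img_open : open (coord @` dom);
  coord_cont : forall p, dom p -> {for p, continuous coord};
  coordV_cont : forall y, (coord @` dom) y -> {for y, continuous coordV};
  coordK : forall p, dom p -> coordV (coord p) = p }.

Definition img (R : realType) n (T : topologicalType) (c : chart R n T) :=
  coord c @` dom c.

Definition smooth_transition (R : realType) n (T : topologicalType)
    (c d : chart R n T) : Prop :=
  smooth_on (coord c @` (dom c `&` dom d)) (coord d \o coordV c).

(* Smooth manifolds of dimension n, with their maximal atlas. *)
Record manifold (R : realType) (n : nat) := Manifold {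
  points :> topologicalType;
  atlas : set (chart R n points);
  points_hausdorff : hausdorff_space points;
  points_second_countable : @second_countable points;
  atlas_cover : forall p : points, exists2 c, atlas c & dom c p;
  atlas_compat : forall c d, atlas c -> atlas d -> smooth_transition c d;
  atlas_maximal : forall c,
    (forall d, atlas d -> smooth_transition c d /\ smooth_transition d c) ->
    atlas c }.

Arguments atlas {R n} _ _.

Definition smooth_map (R : realType) m n (M : manifold R m) (N : manifold R n)
    (F : M -> N) : Prop :=
  continuous F /\
  forall c d, atlas M c -> atlas N d ->
    smooth_on (coord c @` (dom c `&` F @^-1` dom d))
              (coord d \o F \o coordV c).

Definition diffeomorphism (R : realType) m n (M : manifold R m)
    (N : manifold R n) (F : M -> N) : Prop :=
  smooth_map F /\ exists G : N -> M, [/\ smooth_map G, cancel F G & cancel G F].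

(* Submersion: in suitable charts F is the projection of 'rV_(k + n) onto its
   last n coordinates. *)
Definition submersion (R : realType) k n (M : manifold R (k + n))
    (N : manifold R n) (F : M -> N) : Prop :=
  forall x : M, exists c d, [/\ atlas M c, atlas N d, dom c x,
    dom c `<=` F @^-1` dom d &
    forall p, dom c p -> coord d (F p) = rsubmx (coord c p)].

Section SmoothFunctions.
Variables (R : realType) (n : nat) (M : manifold R n).

Definition smooth_fun (f : M -> R^o) : Prop :=
  forall c, atlas M c -> smooth_on (img c) (f \o coordV c).

Definition smooth_pred : {pred M -> R^o} := fun f => `[< smooth_fun f >].

Lemma smooth_pred_submod : submod_closed smooth_pred.
Proof.
split; first by apply/asboolP => c _ k; exact: Ck_cst.
move=> a f g /asboolP sf /asboolP sg; apply/asboolP => c Mc k.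
have oc : open (img c) by exact: img_open.
by apply: CkD (sg c Mc k) => //; apply: CkM (sf c Mc k) => //; exact: Ck_cst.
Qed.

Lemma smooth_pred_mul : mulr_closed smooth_pred.
Proof.
split; first by apply/asboolP => c _ k; exact: Ck_cst.
move=> f g /asboolP sf /asboolP sg; apply/asboolP => c Mc k.
have oc : open (img c) by exact: img_open.
by apply: CkM => //; [exact: sf|exact: sg].
Qed.

HB.instance Definition _ := GRing.isSubmodClosed.Build R (M -> R^o) smooth_pred
  smooth_pred_submod.
HB.instance Definition _ := GRing.isMulClosed.Build (M -> R^o) smooth_pred
  smooth_pred_mul.

(* The R-algebra of smooth functions on M. *)
Record Cinf := MkCinf {
  Cinf_fun :> M -> R^o;
  Cinf_smooth : Cinf_fun \in smooth_pred }.

HB.instance Definition _ := [isSub for Cinf_fun].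
HB.instance Definition _ := [Choice of Cinf by <:].
HB.instance Definition _ := GRing.SubChoice_isSubComPzRing.Build (M -> R^o)
  smooth_pred Cinf (GRing.subringClosedP _).
HB.instance Definition _ := [SubZmodule_isSubLmodule of Cinf by <:].

Lemma CinfP (f g : Cinf) : f =1 g -> f = g.
Proof. by move=> fg; apply: val_inj; apply/funext. Qed.

Lemma Cinf_scalerAl (a : R) (f g : Cinf) : a *: (f * g) = a *: f * g.
Proof. by apply: CinfP => x; exact: mulrA. Qed.

Lemma Cinf_scalerAr (a : R) (f g : Cinf) : a *: (f * g) = f * (a *: g).
Proof. by rewrite mulrC Cinf_scalerAl mulrC. Qed.

End SmoothFunctions.

Section VectorFields.
Variables (R : realType) (n : nat) (M : manifold R n).
Notation A := (Cinf M).

Definition derivation (X : A -> A) : Prop :=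
  (forall (a : R) (f g : A), X (a *: f + g) = a *: X f + X g) /\
  (forall f g : A, X (f * g) = X f * g + f * X g).

(* Vector fields on M are the derivations of its algebra of smooth functions. *)
Record vector_field := VectorField {
  vf_fun :> A -> A;
  vf_derivation : derivation vf_fun }.

Lemma vfP (X Y : vector_field) : X =1 Y -> X = Y.
Proof.
case: X Y => [X dX] [Y dY] /= /funext XY; subst Y.
by congr VectorField; exact: Prop_irrelevance.
Qed.

HB.instance Definition _ := gen_eqMixin vector_field.
HB.instance Definition _ := gen_choiceMixin vector_field.

Fact vf0_subproof : derivation (fun=> 0).
Proof.
by split=> *; rewrite ?scaler0 ?addr0 // mul0r mulr0 addr0.
Qed.
Definition vf0 := VectorField vf0_subproof.

Fact vfD_subproof (X Y : vector_field) : derivation (fun f => X f + Y f).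
Proof.
case: X Y => [X [Xl XL]] [Y [Yl YL]]; split=> [a f g|f g] /=.
  by rewrite Xl Yl scalerDr addrACA.
by rewrite XL YL mulrDl mulrDr addrACA.
Qed.
Definition vfD X Y := VectorField (vfD_subproof X Y).

Fact vfZ_subproof (h : A) (X : vector_field) : derivation (fun f => h * X f).
Proof.
case: X => [X [Xl XL]]; split=> [a f g|f g] /=.
  by rewrite Xl mulrDr Cinf_scalerAr.
by rewrite XL mulrDr mulrA mulrCA.
Qed.
Definition vfZ h X := VectorField (vfZ_subproof h X).

Fact vfN_subproof (X : vector_field) : derivation (fun f => - X f).
Proof.
case: X => [X [Xl XL]]; split=> [a f g|f g] /=.
  by rewrite Xl opprD scalerN.
by rewrite XL opprD mulNr mulrN.
Qed.
Definition vfN X := VectorField (vfN_subproof X).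

Fact vfDA : associative vfD.
Proof. by move=> X Y Z; apply: vfP => f; exact: addrA. Qed.
Fact vfDC : commutative vfD.
Proof. by move=> X Y; apply: vfP => f; exact: addrC. Qed.
Fact vf0D : left_id vf0 vfD.
Proof. by move=> X; apply: vfP => f; exact: add0r. Qed.
Fact vfND : left_inverse vf0 vfN vfD.
Proof. by move=> X; apply: vfP => f; exact: addNr. Qed.

HB.instance Definition _ :=
  GRing.isZmodule.Build vector_field vfDA vfDC vf0D vfND.

Fact vfZA g h X : vfZ g (vfZ h X) = vfZ (g * h) X.
Proof. by apply: vfP => f; exact: mulrA. Qed.
Fact vf1Z : left_id 1 vfZ.
Proof. by move=> X; apply: vfP => f; exact: mul1r. Qed.
Fact vfZDr : right_distributive vfZ +%R.
Proof. by move=> h X Y; apply: vfP => f; exact: mulrDr. Qed.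
Fact vfZDl X : {morph vfZ^~ X : g h / g + h}.
Proof. by move=> g h; apply: vfP => f; exact: mulrDl. Qed.

HB.instance Definition _ :=
  GRing.Zmodule_isLmodule.Build A vector_field vfZA vf1Z vfZDr vfZDl.

Fact lie_subproof (X Y : vector_field) : derivation (fun f => X (Y f) - Y (X f)).
Proof.
case: X Y => [X [Xl XL]] [Y [Yl YL]].
have XD f g : X (f + g) = X f + X g by have := Xl 1 f g; rewrite !scale1r.
have YD f g : Y (f + g) = Y f + Y g by have := Yl 1 f g; rewrite !scale1r.
split=> [a f g|f g] /=; first by rewrite Yl Xl Xl Yl scalerBr opprD addrACA.
rewrite YL XL XD YD !XL !YL; ring.
Qed.
Definition lie X Y := VectorField (lie_subproof X Y).

Definition lin_indep (X Y : vector_field) : Prop :=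
  forall (x : M) (a b : R),
    (forall f : A, a * X f x + b * Y f x = 0) -> a = 0 /\ b = 0.

(* Tangent vectors at x, as derivations at x. *)
Definition tangent_vector (x : M) (v : A -> R) : Prop :=
  (forall (a : R) (f g : A), v (a *: f + g) = a * v f + v g) /\
  (forall f g : A, v (f * g) = v f * g x + f x * v g).

End VectorFields.

Section Forms.
Variables (R : realType) (n : nat) (M : manifold R n).
Notation A := (Cinf M).
Notation VF := (vector_field M).

(* Differential k-forms are the alternating k-linear maps over smooth functions
   satisfying [is_form]; the operations below are defined on all functions of
   this type. *)
Definition preform k := ('I_k -> VF) -> A.

Definition is_form k (alpha : preform k) : Prop :=
  (forall (Y : 'I_k -> VF) i (f : A) (X X' : VF),
     alpha [eta Y with i |-> f *: X + X'] =
     f * alpha [eta Y with i |-> X] + alpha [eta Y with i |-> X']) /\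
  (forall (Y : 'I_k -> VF) i j, i != j -> Y i = Y j -> alpha Y = 0).

Definition volume_form (omega : preform n) : Prop :=
  is_form omega /\ forall x : M, exists Y, omega Y x != 0.

Definition fcons k (X : VF) (Y : 'I_k -> VF) (i : 'I_k.+1) : VF :=
  if unlift ord0 i is Some j then Y j else X.

Definition iprod k (X : VF) (alpha : preform k.+1) : preform k :=
  fun Y => alpha (fcons X Y).

Definition lie_derivative k (X : VF) (alpha : preform k) : preform k :=
  fun Y => X (alpha Y) - \sum_(i < k) alpha [eta Y with i |-> lie X (Y i)].

(* Koszul formula.  In the second sum the arguments of alpha are lie (Y i) (Y j)
   followed by the Y l with l different from i and j, in order. *)
Definition ext_d k (alpha : preform k) : preform k.+1 :=
  fun Y => \sum_(i < k.+1) (-1) ^+ i * Y i (alpha (Y \o lift i)) +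
    \sum_(i < k.+1) \sum_(j < k.+1 | (i < j)%N)
      (-1) ^+ (i + j) *
      alpha (fun l => if l == 0 :> nat then lie (Y i) (Y j)
                      else Y (inord (bump j (bump i l.-1)))).

(* Bivectors, identified with the brackets of functions they define. *)
Definition bivector := A -> A -> A.

Definition is_bivector (P : bivector) : Prop :=
  (forall f g : A, P f g = - P g f) /\ (forall f : A, derivation (P f)).

Definition wedge (X Y : VF) : bivector := fun f g => X f * Y g - Y f * X g.

Definition poisson_bivector (P : bivector) : Prop :=
  is_bivector P /\
  forall f g h : A, P f (P g h) + P g (P h f) + P h (P f g) = 0.

Definition compatible (P1 P2 : bivector) : Prop :=
  [/\ poisson_bivector P1, poisson_bivector P2 & poisson_bivector (fun f g => P1 f g + P2 f g)].

End Forms.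

(* F-relatedness of vector fields, that is TF o X = Y o F. *)
Definition related (R : realType) m n (M : manifold R m) (N : manifold R n)
    (F : M -> N) (X : vector_field M) (Y : vector_field N) : Prop :=
  forall (f : Cinf N) (g : Cinf M), g =1 f \o F -> X g =1 Y f \o F.

Definition vertical (R : realType) m n (M : manifold R m) (N : manifold R n)
    (F : M -> N) (v : Cinf M -> R) : Prop :=
  forall (f : Cinf N) (g : Cinf M), g =1 f \o F -> v g = 0.

(* The foliation generated by X1, X2 is the fibration F: its leaves are the
   fibres of F, which are connected and tangent to X1, X2. *)
Definition fibration (R : realType) n (M : manifold R n.+2) (N : manifold R n)
    (F : M -> N) (X1 X2 : vector_field M) : Prop :=
  [/\ smooth_map F,
      forall y, exists x, F x = y,
      submersion (k := 2) F,
      forall y, connected (F @^-1` [set y]) &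
      forall (x : M) (v : Cinf M -> R), tangent_vector x v ->
        vertical F v <-> exists a b : R, v = fun f => a * X1 f x + b * X2 f x].

Definition preserves_form (R : realType) n k (M : manifold R n) (phi : M -> M)
    (omega : preform M k) : Prop :=
  forall Y Y' : 'I_k -> vector_field M, (forall i, related phi (Y i) (Y' i)) ->
    omega Y =1 omega Y' \o phi.

Definition carries_bivector (R : realType) n (M : manifold R n) (phi : M -> M)
    (P P' : bivector M) : Prop :=
  forall f g f' g' : Cinf M, f =1 f' \o phi -> g =1 g' \o phi ->
    P f g =1 P' f' g' \o phi.

Section Matching.
Variables (R : realType) (n : nat) (M : manifold R n.+2).
Variable omega : preform M n.+2.
Notation VF := (vector_field M).

(* P = X /\ Xi is a presentation of P as an omega-modular bivector. *)
Definition modular_presentation (P : bivector M) (X Xi : VF) : Prop :=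
  [/\ P = wedge X Xi, lie X Xi = 0,
      lie_derivative Xi omega = (fun=> 0) & lie_derivative X omega = omega].

Definition modular_bivector (P : bivector M) : Prop :=
  exists X Xi, modular_presentation P X Xi.

(* Xi is the omega-modular field of the decomposable bivector P:
   i_Xi omega = d (i_P omega), where i_(X /\ Y) = i_X o i_Y. *)
Definition modular_field (P : bivector M) (Xi : VF) : Prop :=
  exists X Y, P = wedge X Y /\
    iprod Xi omega = ext_d (iprod X (iprod Y omega)).

Definition matching (P1 P2 : bivector M) : Prop :=
  [/\ modular_bivector P1, modular_bivector P2 & compatible P1 P2].

Definition fibred_matching (N : manifold R n) (pi : M -> N)
    (P1 P2 : bivector M) : Prop :=
  matching P1 P2 /\
  exists Xi1 Xi2, [/\ modular_field P1 Xi1, modular_field P2 Xi2,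
    lin_indep Xi1 Xi2, lie Xi1 Xi2 = 0 & fibration pi Xi1 Xi2].

Definition structure_equations (X1 Xi1 X2 Xi2 : VF)
    (f1 f2 lambda mu1 mu2 : Cinf M) : Prop :=
  [/\ lie X1 Xi2 = f1 *: Xi1 + lambda *: Xi2,
      lie X2 Xi1 = lambda *: Xi1 + f2 *: Xi2 &
      lie X1 X2 = lambda *: (X1 - X2) + mu1 *: Xi1 - mu2 *: Xi2].

End Matching.

Record base_data (R : realType) n (N : manifold R n) := BaseData {
  bd_Z : vector_field N;
  bd_W : vector_field N;
  bd_z : Cinf N;
  bd_u : Cinf N;
  bd_v : Cinf N }.

(* D is the data on N associated with the matching (P1, P2), for some choice of
   normalised (f1 = f2 = 0) fields X1, X2. *)
Definition associated (R : realType) n (M : manifold R n.+2)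
    (omega : preform M n.+2) (N : manifold R n) (pi : M -> N)
    (P1 P2 : bivector M) (D : base_data N) : Prop :=
  exists (Xi1 Xi2 X1 X2 : vector_field M) (lambda mu1 mu2 : Cinf M)
         (nu1 nu2 : Cinf N),
  [/\ modular_field omega P1 Xi1 /\ modular_field omega P2 Xi2,
      modular_presentation omega P1 X1 Xi1 /\
        modular_presentation omega P2 X2 Xi2,
      structure_equations X1 Xi1 X2 Xi2 0 0 lambda mu1 mu2,
      related pi (X1 - X2) (bd_Z D) /\ related pi (X1 + X2) (bd_W D) &
      [/\ lambda =1 bd_z D \o pi,
          Xi1 mu1 =1 nu1 \o pi /\ Xi2 mu2 =1 nu2 \o pi,
          bd_u D = nu2 - nu1 & bd_v D = nu1 + nu2]].

Definition carries_data (R : realType) n (N N' : manifold R n) (psi : N -> N')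
    (D : base_data N) (D' : base_data N') : Prop :=
  [/\ related psi (bd_Z D) (bd_Z D'), related psi (bd_W D) (bd_W D'),
      bd_z D =1 bd_z D' \o psi, bd_u D =1 bd_u D' \o psi &
      bd_v D =1 bd_v D' \o psi].

(* Main.v *)
From HB Require Import structures.
From mathcomp Require Import all_boot all_order all_algebra.
From mathcomp Require Import all_classical all_reals interval_inference.
From mathcomp Require Import ring lra.
From mathcomp Require Import topology normedtype landau derive realfun sequences exp.
From mathcomp Require Import measure lebesgue_measure lebesgue_integral ftc.
Require Import Defs.

(** Why the data are invariant.

    The modular field of P = X /\ Y is defined by i_Xi omega = d (i_X i_Y omega),
    and both sides only see P: the contraction i_X i_Y omega is determined by the
    bracket P, and a volume form is nondegenerate, so Xi is determined by P and
    omega ([modular_field_unique]).  As forms are multilinear maps on derivations,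
    these two facts rest on the theorem that the derivations of the algebra of
    smooth functions form, near each point, a module spanned by as many fields
    as the dimension ([local_frame]); this is where bump functions
    ([chart_bump]) and Hadamard's lemma ([hadamard]) enter.

    Once Xi1, Xi2 are fixed, two presentations P_i = X_i /\ Xi_i = X_i' /\ Xi_i
    differ by X_i' = X_i + g_i Xi_i, with g_i smooth since Xi_i vanishes nowhere
    ([wedge_same_left], from the division lemma [Cinf_divide]).  The commutation
    relations force Xi_j g_i = 0 for all i, j and leave lambda unchanged
    ([gauge_diag], [gauge_cross]), while
      mu1' = mu1 - X2 g1 - 2 lambda g1,   mu2' = mu2 - X1 g2 - 2 lambda g2.
    The corrections are annihilated by Xi1, respectively Xi2, because lambda comes
    from the base and Xi1 X2 g1 = X2 Xi1 g1 - lambda Xi1 g1 = 0; hence the Xi_i mu_i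
    do not change ([gauge_mu]).  The fields X1 -+ X2 change by vertical fields, so
    their projections do not change either.  Altogether the base data depend on
    the matching only ([associated_unique]).

    For a diffeomorphism phi preserving omega and carrying one matching to another,
    all the constructions are natural under push-forward of fields, so the
    modular fields of the first matching are carried to those of the second.
    A function pulled back by pi' o phi is therefore killed by Xi1 and Xi2, hence is
    constant on the connected fibres of pi ([fibre_constant]); as smooth functions
    separate points, pi' o phi itself descends to a map psi of the bases, which is
    smooth because pi has local sections ([induced_map]).  The same argument for
    the inverse of phi shows that psi is a diffeomorphism.  Finally, the push-forward
    by psi of base data of the first matching is base data of the second
    ([push_associated]), and uniqueness identifies it with any other choice. *)

Set Implicit Arguments.
Unset Strict Implicit.
Unset Printing Implicit Defensive.

Import Order.TTheory GRing.Theory Num.Theory.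
Import numFieldNormedType.Exports.

Local Open Scope classical_set_scope.
Local Open Scope ring_scope.

(** * Calculus of functions of class C^k *)

Section CkGeneral.
Variables (R : realType) (V : normedModType R).
Implicit Types (U : set V).

Lemma Ck_local (W : normedModType R) k U (f : V -> W) :
  (forall x, U x -> exists U', [/\ open U', U' x & Ck k U' f]) -> Ck k U f.
Proof.
elim: k f => [|k IH] f loc /=.
  by move=> x /loc[U' [_ U'x cf]]; exact: cf.
split=> [x /loc[U' [_ U'x [df _]]]|v]; first exact: df.
by apply: IH => x /loc[U' [oU' U'x [_ Df]]]; exists U'; split => //; exact: Df.
Qed.

Lemma Ck_sub (W : normedModType R) k (U U' : set V) (f : V -> W) :
  U' `<=` U -> Ck k U f -> Ck k U' f.
Proof.
move=> UU; elim: k f => [|k IH] f /=; first by move=> cf x /UU; exact: cf.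
by move=> [df Df]; split=> [x /UU|v]; [exact: df|exact: IH (Df v)].
Qed.

(** Reduces maps between charts to real-valued functions, for which products and
    quotients are available. *)
Lemma Ck_rowP n k U (f : V -> 'rV[R]_n) : open U ->
  Ck k U f <-> forall i, Ck k U (fun x => f x 0 i : R^o).
Proof.
move=> oU.
have fE (g : V -> 'rV[R]_n) : g = \sum_(i < n)
    ((fun x : V => g x 0 i *: (delta_mx 0 i : 'rV[R]_n)) : V -> 'rV[R]_n).
  by apply/funext => x; rewrite fct_sumE; exact: row_sum_delta.
elim: k f => [|k IH] f.
  split=> [cf i x Ux|cf x Ux].
    apply: (@continuous_comp _ _ _ f (fun M : 'rV[R]_n => M 0 i)); first exact: cf.
    exact: coord_continuous.
  rewrite (fE f); elim/big_ind: _ => [|u v cu cv|i _].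
  - exact: cst_continuous.
  - exact: continuousD.
  - by apply: cvgZr_tmp; exact: cf.
split=> [[df Df] i|cf].
  split=> [x Ux|v].
    apply: (@differentiable_comp _ _ _ _ f (fun M : 'rV[R]_n => M 0 i)) (df x Ux) _.
    exact: differentiable_coord.
  apply: (Ck_ext oU _ ((IH _).1 (Df v) i)) => x Ux.
  by rewrite derive_mx ?mxE//; apply: diff_derivable; exact: df.
have df x : U x -> differentiable f x.
  move=> Ux; rewrite (fE f); apply: differentiable_sum => i.
  by apply: differentiableZl; have [+ _] := cf i; exact.
split=> // v; apply/(IH _).2 => i.
have [_ /(_ v)] := cf i; apply: Ck_ext => // x Ux.
by rewrite derive_mx ?mxE//; apply: diff_derivable; exact: df.
Qed.

Lemma Ck_sum n k U (f : 'I_n -> V -> R^o) : open U ->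
  (forall i, Ck k U (f i)) -> Ck k U (fun x => \sum_i f i x).
Proof.
move=> oU cf; rewrite (_ : (fun x => _) = \sum_i f i); last first.
  by apply/funext => x; rewrite fct_sumE.
elim/big_ind: _ => [|u v|i _] //; first exact: (Ck_cst k U 0).
exact: CkD.
Qed.

Lemma CkN k U (f : V -> R^o) : open U -> Ck k U f -> Ck k U (fun x => - f x).
Proof.
move=> oU cf; have := CkM oU (Ck_cst k U (-1)) cf.
by apply: Ck_ext => // x _; rewrite mulN1r.
Qed.

Lemma CkB k U (f g : V -> R^o) : open U -> Ck k U f -> Ck k U g ->
  Ck k U (fun x => f x - g x).
Proof. by move=> oU cf cg; exact: (CkD oU cf (CkN oU cg)). Qed.

Lemma CkV k U (f : V -> R^o) : open U -> (forall x, U x -> f x != 0) ->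
  Ck k U f -> Ck k U (fun x => (f x)^-1 : R^o).
Proof.
move=> oU f0; elim: k => [|k IH] cf.
  by move=> x Ux; apply: (@cvgV R); [exact: f0|exact: cf].
have cV := IH (Ck_pred cf); have [df Df] := cf; split=> [x Ux|v].
  by apply: differentiableV; [exact: df|exact: f0].
have := CkN oU (CkM oU (CkM oU cV cV) (Df v)); apply: Ck_ext => // x Ux.
rewrite (deriveV (f0 _ Ux)) /=; last by apply: diff_derivable; exact: df.
by rewrite -[RHS]/(- (f x) ^- 2 * 'D_v f x) mulNr expr2 invfM.
Qed.

End CkGeneral.

Section CkComp.
Variables (R : realType) (V : normedModType R).

Lemma derive_row n (W : normedModType R) (f : 'rV[R]_n -> W) y w :
  differentiable f y ->
  'D_w f y = \sum_i w 0 i *: 'D_(delta_mx 0 i) f y.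
Proof.
move=> df; rewrite deriveE// {1}(row_sum_delta w) linear_sum.
by apply: eq_bigr => i _; rewrite linearZ deriveE.
Qed.

(** By the chain rule D_v (f o g) is the sum over i of D_v g_i times
    (D_i f) o g, which closes an induction on k. *)
Lemma Ck_comp n k (U : set V) (U' : set 'rV[R]_n) (g : V -> 'rV[R]_n)
    (f : 'rV[R]_n -> R^o) :
  open U -> open U' -> (forall x, U x -> U' (g x)) ->
  Ck k U g -> Ck k U' f -> Ck k U (f \o g).
Proof.
move=> oU oU' gU; elim: k f => [|k IH] f cg cf.
  by move=> x Ux; apply: continuous_comp; [exact: cg|exact: cf (gU _ Ux)].
have [[dg Dg] [df Df]] := (cg, cf); split=> [x Ux|v].
  by apply: differentiable_comp; [exact: dg|exact: df (gU _ Ux)].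
have cg' : Ck k U g.
  by apply/(Ck_rowP _ _ oU) => i; apply: Ck_pred; exact: (Ck_rowP _ _ oU).1.
apply: (Ck_ext oU (f := fun x => \sum_i
    ('D_v g x 0 i : R^o) * ('D_(delta_mx 0 i) f \o g) x)).
  move=> x Ux; rewrite [RHS]deriveE; last first.
    by apply: differentiable_comp; [exact: dg|exact: df (gU _ Ux)].
  rewrite (diff_comp (dg _ Ux) (df _ (gU _ Ux))) /= -deriveE; last exact: df (gU _ Ux).
  rewrite derive_row; last exact: df (gU _ Ux).
  by apply: eq_bigr => i _; rewrite deriveE//; exact: dg.
apply: Ck_sum => // i; apply: CkM => //;
  first exact: ((Ck_rowP k ('D_v g) oU).1 (Dg v) i).
exact: IH cg' (Df _).
Qed.

Lemma Ck_comp_row m n k (U : set V) (U' : set 'rV[R]_n) (g : V -> 'rV[R]_n)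
    (f : 'rV[R]_n -> 'rV[R]_m) :
  open U -> open U' -> (forall x, U x -> U' (g x)) ->
  Ck k U g -> Ck k U' f -> Ck k U (f \o g).
Proof.
move=> oU oU' gU cg /(Ck_rowP _ _ oU') cf; apply/(Ck_rowP _ _ oU) => i.
exact: (Ck_comp oU oU' gU cg (cf i)).
Qed.

Lemma Ck_const (W : normedModType R) k (U : set V) (w : W) :
  Ck k U (fun=> w).
Proof.
elim: k w => [|k IH] w /=; first by move=> x _; exact: cst_continuous.
split=> [x _|v]; first exact: differentiable_cst.
have -> : 'D_v (fun=> w) = (fun=> 0) :> (V -> W).
  by apply/funext => x; exact: derive_cst.
exact: IH.
Qed.

Lemma Ck_id k (U : set V) : open U -> Ck k U (@id V).
Proof.
move=> oU; case: k => [|k]; first by move=> x Ux; exact: cvg_id.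
split=> [x Ux|v]; first by apply: (@ex_diff _ _ _ _ _ id); exact: is_diff_id.
have -> : 'D_v id = (fun=> v) :> (V -> V) by apply/funext => x; exact: derive_id.
exact: Ck_const.
Qed.

End CkComp.

Lemma Ck_coord (R : realType) n k (U : set 'rV[R]_n) i : open U ->
  Ck k U (fun y : 'rV[R]_n => y 0 i : R^o).
Proof. by move=> oU; exact: (Ck_rowP k (@id 'rV[R]_n) oU).1 (Ck_id k oU) i. Qed.

(** * Functions flat at the origin *)

Section Flat.
Variable R : realType.
Implicit Types (t : R) (j k : nat).

(** t^-j exp (-1/t), extended by zero to t <= 0.  The exponent j is a parameter
    because differentiation acts within the span of this family. *)
Definition flat j t : R := if 0 < t then t^-1 ^+ j * expR (- t^-1) else 0.

Lemma flat_le0 j t : t <= 0 -> flat j t = 0.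
Proof. by rewrite /flat ltNge => ->. Qed.

Lemma flat_gt0 j t : 0 < t -> 0 < flat j t.
Proof. by move=> t0; rewrite /flat t0 mulr_gt0 ?expR_gt0 ?exprn_gt0 ?invr_gt0. Qed.

Lemma flatS j t : flat j.+1 t = t^-1 * flat j t.
Proof. by rewrite /flat; case: ifP => _; rewrite ?mulr0// exprS mulrA. Qed.

(** Since exp s >= s^(j+1) / (j+1)! for s = 1/t, the exponential absorbs the pole.
    Applied to j+1, the bound makes the difference quotient of [flat j] at 0, which
    is [flat j.+1], tend to 0. *)
Lemma flat_le j t : 0 < t -> flat j t <= j.+1`!%:R * t.
Proof.
move=> t0; rewrite /flat t0; set s := t^-1.
have s0 : 0 < s by rewrite invr_gt0.
have -> : t = s^-1 by rewrite invrK.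
rewrite expRN ler_pdivrMr ?expR_gt0// -mulrA mulrC.
have f0 : 0 < (j.+1)`!%:R :> R by rewrite ltr0n fact_gt0.
rewrite -ler_pdivrMr// [leRHS]mulrC ler_pdivlMr// mulrAC -exprSr.
by rewrite (le_trans _ (expR_ge1Dxn j (ltW s0)))// lerDr.
Qed.

Lemma is_derive_flat j t :
  is_derive t (1 : R) (flat j : R -> R^o) (flat j.+2 t - j%:R * flat j.+1 t).
Proof.
have [t0|t0|->] := ltgtP t 0.
- rewrite !flat_le0 ?(ltW t0)// mulr0 subrr.
  apply: near_eq_is_derive (is_derive_cst (0 : R^o) t 1).
  by near=> s; rewrite flat_le0// ltW//; near: s; exact: lt_nbhsl.
- have t0' : t != 0 by rewrite gt_eqF.
  pose g (s : R) : R^o := s^-1 ^+ j * expR (- s^-1).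
  apply: (@near_eq_is_derive R R R^o g).
    near=> s; rewrite /flat ifT//; near: s; exact: lt_nbhsr.
  have dV : is_derive t (1 : R) (fun s : R => s^-1) (- t ^- 2).
    by apply: DeriveDef; [exact: derivableV|rewrite deriveV// derive_id scaler1].
  have dE : is_derive t (1 : R) (fun s : R => expR (- s^-1)) (t ^- 2 * expR (- t^-1)).
    have := @is_derive1_comp R expR (fun s : R => - s^-1) t _ _
      (is_derive_expR _) (is_deriveN dV).
    by rewrite opprK mulrC.
  have dX := is_deriveX j dV.
  have := is_deriveM dX dE; rewrite exprfctE => dXE.
  apply: (is_derive_eq (f := g) dXE).
  rewrite /flat t0 -![_ *: _]/(_ * _) -!exprVn.
  by case: (j) => [|i] /=; rewrite !exprS; ring.
- rewrite !flat_le0// mulr0 subrr.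
  suff cv : s^-1 *: (flat j (s *: 1 + 0) - flat j 0) @[s --> (0 : R)^'] --> (0 : R^o).
    by apply: DeriveDef; [apply/cvg_ex; exists 0|exact: cvg_lim cv].
  apply/cvgrPdist_le => e e0.
  have f0 : 0 < (j.+2)`!%:R :> R by rewrite ltr0n fact_gt0.
  near=> s; rewrite sub0r normrN [s *: 1]mulr1 addr0 (@flat_le0 j 0)// subr0.
  rewrite -[_ *: _]/(s^-1 * _) -flatS.
  have [s0|s0] := ltP 0 s; last by rewrite flat_le0// normr0 ltW.
  rewrite gtr0_norm ?flat_gt0// (le_trans (flat_le _ s0))// mulrC -ler_pdivlMr//.
  rewrite (le_trans (ler_norm s))//; near: s; apply: dnbhs0_le.
  by rewrite divr_gt0.
Unshelve. all: by end_near. Qed.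

(** Smoothness needs no higher derivative computation: a derivative of a member of
    the family is a combination of two members, so induction on k applies to all
    members at once. *)
Lemma Ck_flat (V : normedModType R) k j (U : set V) (q : V -> R^o) :
  open U -> Ck k U q -> Ck k U (fun x => flat j (q x) : R^o).
Proof.
move=> oU; elim: k j => [|k IH] j cq.
  move=> x Ux; apply: (@continuous_comp _ _ _ q (flat j)); first exact: cq.
  by apply/differentiable_continuous/derivable1_diffP; case: (is_derive_flat j (q x)).
have [dq Dq] := cq.
have df y : differentiable (flat j : R -> R^o) y.
  by apply/derivable1_diffP; case: (is_derive_flat j y).
split=> [x Ux|v].
  by apply: (@differentiable_comp _ _ _ _ q (flat j)); [exact: dq|exact: df].
have cq' := Ck_pred cq.
apply: (Ck_ext oU (f := fun x =>
   ((flat j.+2 (q x) + (- j%:R) * flat j.+1 (q x) : R^o) * 'D_v q x : R^o))).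
  move=> x Ux; rewrite [RHS]deriveE; last first.
    by apply: (@differentiable_comp _ _ _ _ q (flat j)); [exact: dq|exact: df].
  rewrite (@diff_comp _ _ _ _ q (flat j)) /=; [|exact: dq|exact: df].
  rewrite -(deriveE _ (dq _ Ux)) -[in RHS](mulr1 ('D_v q x)).
  rewrite -['D_v q x * 1]/('D_v q x *: (1:R)) linearZ /= -deriveE; last exact: df.
  by rewrite (@derive_val _ _ _ _ _ _ _ (is_derive_flat j (q x))) mulNr mulrC.
have c1 : Ck k U (fun x => (- j%:R : R) * flat j.+1 (q x) : R^o).
  by apply: CkM => //; [exact: Ck_cst|exact: IH].
exact: (CkM oU (CkD oU (IH j.+2 cq') c1) (Dq v)).
Qed.

End Flat.

(** * Integration over the unit interval *)

Lemma differentiable_estimate (R : realType) (V W : normedModType R)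
    (f : V -> W) (L : {linear V -> W}) (x : V) : continuous L ->
  (forall e : R, 0 < e ->
     \forall h \near (0 : V), `|f (h + x) - f x - L h| <= e * `|h|) ->
  differentiable f x /\ 'd f x = L :> (V -> W).
Proof.
move=> cL est.
have fE : f \o shift x = cst (f x) + L +o_ 0 id.
  apply/eqaddoP => _/posnumP[e].
  apply: filterS (est _ [gt0 of e%:num]) => h /=.
  by rewrite -[(_ - _ : V -> W) h]/(f (h + x) - (f x + L h)) opprD addrA.
have dE := diff_unique cL fE.
by split=> //; apply/diff_locallyP; rewrite dE.
Qed.

Section UnitIntegral.
Variable R : realType.
Implicit Types u v : R -> R.

Definition int01 u : R := \int[@lebesgue_measure R]_(s in `[0, 1]) u s.

Definition cont01 u : Prop := forall s : R, 0 <= s <= 1 -> {for s, continuous u}.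

Lemma cont01_within u : cont01 u -> {within `[0, 1], continuous u}.
Proof.
move=> cu; apply: continuous_in_subspaceT => s.
by rewrite inE /= in_itv /=; exact: cu.
Qed.

Lemma int01_integrable u : cont01 u ->
  (@lebesgue_measure R).-integrable `[0, 1] (EFin \o u).
Proof.
move=> /cont01_within cu; apply: continuous_compact_integrable cu.
exact: segment_compact.
Qed.

Lemma cont01Z a u : cont01 u -> cont01 (fun s => a * u s).
Proof. by move=> cu s s01; apply: cvgM; [exact: cvg_cst|exact: cu]. Qed.

Lemma cont01B u v : cont01 u -> cont01 v -> cont01 (fun s => u s - v s).
Proof. by move=> cu cv s s01; apply: (@cvgB _ R); [exact: cu|exact: cv]. Qed.

Lemma cont01_sum n (u : 'I_n -> R -> R) :
  (forall i, cont01 (u i)) -> cont01 (fun s => \sum_i u i s).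
Proof.
move=> cu s s01; rewrite (_ : (fun _ => _) = \sum_i u i); last first.
  by apply/funext => x; rewrite fct_sumE.
elim/big_ind: _ => [|f g|i _].
- exact: cst_continuous.
- exact: (@continuousD R R R).
- exact: cu.
Qed.

Lemma int01Z a u : cont01 u -> int01 (fun s => a * u s) = a * int01 u.
Proof. by move=> cu; rewrite /int01 RintegralZl//; exact: int01_integrable. Qed.

Lemma int01B u v : cont01 u -> cont01 v ->
  int01 (fun s => u s - v s) = int01 u - int01 v.
Proof. by move=> cu cv; rewrite /int01 RintegralB//; exact: int01_integrable. Qed.

Lemma int01_sum n (u : 'I_n -> R -> R) :
  (forall i, cont01 (u i)) -> int01 (fun s => \sum_i u i s) = \sum_i int01 (u i).
Proof.
elim: n u => [|n IH] u cu.
  under eq_fun do rewrite big_ord0.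
  by rewrite big_ord0 /int01 Rintegral_cst// mul0r.
under eq_fun do rewrite big_ord_recl.
rewrite big_ord_recl -IH => [|i]; last exact: cu.
rewrite /int01 RintegralD//; first exact/int01_integrable/cu.
by apply/int01_integrable/cont01_sum => i; exact: cu.
Qed.

Lemma int01_le u (a : R) : cont01 u ->
  (forall s, 0 <= s <= 1 -> `|u s| <= a) -> `|int01 u| <= a.
Proof.
move=> cu ua; have cn : cont01 (fun s => `|u s|).
  by move=> s s01; apply: (@continuous_comp _ _ _ u);
    [exact: cu|exact: norm_continuous].
apply: le_trans (le_normr_Rintegral _ (int01_integrable cu)) _ => //.
rewrite [leRHS](_ : a = int01 (cst a)).
  apply: le_Rintegral => //; first exact: int01_integrable.
  by apply: int01_integrable => s _; exact: cvg_cst.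
by rewrite /int01 Rintegral_cst//=
    lebesgue_measure_itv/= lte_fin ltr01 oppr0 adde0 mulr1.
Qed.

Lemma int01_FTC u F : cont01 u ->
  (forall s : R, 0 <= s <= 1 -> is_derive s 1 F (u s)) -> int01 u = F 1 - F 0.
Proof.
move=> cu dF.
have cF : cont01 F.
  by move=> s s01; apply/differentiable_continuous/derivable1_diffP; case: (dF s s01).
rewrite /int01 /Rintegral (@continuous_FTC2 R u F) ?ltr01//.
- exact: cont01_within.
- split.
  + by move=> s; rewrite in_itv/= => /andP[/ltW s0 /ltW s1]; case: (dF s); rewrite ?s0.
  + by apply: cvg_at_right_filter; apply: cF; rewrite lexx ler01.
  + by apply: cvg_at_left_filter; apply: cF; rewrite lexx ler01.
- move=> s; rewrite in_itv/= => /andP[/ltW s0 /ltW s1].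
  by rewrite derive1E; apply: derive_val; apply: dF; rewrite s0.
Qed.

End UnitIntegral.

(** * Hadamard's lemma *)

Section Hadamard.
Variables (R : realType) (n : nat) (y0 : 'rV[R]_n) (r : R).
Notation B := (ball y0 r).
Implicit Types (F : 'rV[R]_n -> R^o) (y h : 'rV[R]_n) (s : R).

Definition segment_point y s : 'rV[R]_n := y0 + s *: (y - y0).

Lemma segment_point_ball y s : 0 <= s <= 1 -> B y -> B (segment_point y s).
Proof.
rewrite -!ball_normE /ball_/= => /andP[s0 s1] yB.
rewrite opprD addNKr normrN normrZ ger0_norm// distrC (le_lt_trans _ yB)//.
by rewrite ler_piMl.
Qed.

Lemma segment_pointD y h s t :
  segment_point (t *: h + y) s = (t * s) *: h + segment_point y s.
Proof.
by rewrite /segment_point -addrA scalerDr scalerA [s * t]mulrC addrCA.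
Qed.

Lemma segment_point_continuous y : continuous (segment_point y).
Proof.
by move=> s; apply: cvgD; [exact: cvg_cst|apply: cvgZr_tmp; exact: cvg_id].
Qed.

(** Differentiating under the integral sign produces a factor s at each step; the
    weight s^j keeps the family of these integrals stable under differentiation. *)
Definition radial_integral j F y : R^o :=
  int01 (fun s => s ^+ j * F (segment_point y s)).

Lemma cont01_seg j F y : Ck 0 B F -> B y ->
  cont01 (fun s => s ^+ j * F (segment_point y s)).
Proof.
move=> cF yB s s01; apply: cvgM; first exact: exprn_continuous.
apply: (@continuous_comp _ _ _ (segment_point y) F);
  first exact: segment_point_continuous.
by apply: cF; exact: segment_point_ball.
Qed.

(** Compactness of [0, 1] makes the continuity of F along the segment uniform. *)
Lemma radial_integral_uniform F y : Ck 0 B F -> B y -> forall e : R, 0 < e ->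
  \forall h \near (0 : 'rV[R]_n), forall s, 0 <= s <= 1 ->
    `|F (segment_point (h + y) s) - F (segment_point y s)| <= e.
Proof.
move=> cF yB e e0.
have /compact_near_coveringP cov := @segment_compact R 0 1.
suff loc s : `[0, 1]%classic s -> \forall s' \near s & h \near (0 : 'rV[R]_n),
    `|F (segment_point (h + y) s') - F (segment_point y s')| <= e.
  have := cov _ (nbhs (0 : 'rV[R]_n))
    (fun h s => `|F (segment_point (h + y) s) - F (segment_point y s)| <= e) _ loc.
  by move=> H; apply: filterS (H _) => h sub s' s01; apply: sub; rewrite /= in_itv.
move=> s01; have {}s01 : 0 <= s <= 1 by move: s01; rewrite /= in_itv.
have cFs : {for segment_point y s, continuous F}.
  by apply: cF; exact: segment_point_ball.
have c1 : F (segment_point (p.2 + y) p.1)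
    @[p --> (s, 0 : 'rV[R]_n)] --> F (segment_point y s).
  apply: continuous_cvg => //; rewrite -{2}(add0r y).
  apply: cvgD; first exact: cvg_cst.
  apply: cvgZ; first exact: cvg_fst.
  by apply: cvgB; [apply: cvgD; [exact: cvg_snd|exact: cvg_cst]|exact: cvg_cst].
have c2 : F (segment_point y p.1) @[p --> (s, 0 : 'rV[R]_n)] --> F (segment_point y s).
  apply: continuous_cvg => //.
  by apply: cvgD; [exact: cvg_cst|apply: cvgZr_tmp; exact: cvg_fst].
have := cvgB c1 c2 => /(_ (nbhs_filter _)); rewrite subrr => /cvgrPdist_le /(_ e e0).
by apply: filterS => -[s' h] /=; rewrite sub0r normrN.
Qed.

Lemma derivable_line F y h t : differentiable F (t *: h + y) ->
  is_derive t (1 : R) (fun t => F (t *: h + y)) ('D_h F (t *: h + y)).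
Proof.
move=> dF.
have dl : is_diff t (fun t : R => t *: h + y) (fun t => t *: h).
  have -> : (fun t : R => t *: h) = ( *:%R ^~ h) + 0 :> (R -> _).
    by apply/funext => s; rewrite fctE addr0.
  exact: is_diffD.
apply: DeriveDef.
  by apply/derivable1_diffP; apply: (@differentiable_comp _ _ _ _ _ F).
rewrite deriveE; last by apply: (@differentiable_comp _ _ _ _ _ F).
by rewrite (@diff_comp _ _ _ _ _ F)//= diff_val scale1r deriveE.
Qed.

(** Differentiation under the integral sign.  For fixed s, the mean value theorem
    turns the first-order remainder into increments of the partial derivatives of F
    along the segment, which are uniformly small. *)
Lemma radial_integral_differentiable j F y : Ck 1 B F -> B y ->
  differentiable (radial_integral j F) y /\
  forall w, 'D_w (radial_integral j F) y = radial_integral j.+1 ('D_w F) y.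
Proof.
move=> [dF DF] yB.
have cF : Ck 0 B F by apply: Ck_pred.
pose e_ (i : 'I_n) : 'rV[R]_n := delta_mx 0 i.
pose c (i : 'I_n) := radial_integral j.+1 ('D_(e_ i) F) y.
pose L (w : 'rV[R]_n) : R^o := \sum_i w 0 i * c i.
have linL : linear L.
  move=> a u v; rewrite /L scaler_sumr -big_split/=; apply: eq_bigr => i _.
  by rewrite !mxE mulrDl -[_ *: (_ * _)]/(_ * (_ * _)) mulrA.
pose L' : {linear 'rV[R]_n -> R^o} := HB.pack L (GRing.isLinear.Build _ _ _ _ _ linL).
have cL : continuous L'.
  have [cL] : Ck 1 setT L; last first.
    by move=> _ w; apply: differentiable_continuous; exact: cL.
  apply: (@Ck_sum R 'rV[R]_n n 1 setT (fun i w => w 0 i * c i : R^o) openT) => i.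
  by apply: CkM (openT) _ (Ck_cst _ _ _); exact: Ck_coord openT.
have cD i : cont01 (fun s => s ^+ j.+1 * 'D_(e_ i) F (segment_point y s)).
  exact: (@cont01_seg j.+1 ('D_(e_ i) F) y (DF (e_ i)) yB).
have sumE (w : 'rV[R]_n) : \sum_i w 0 i * c i =
    int01 (fun s => \sum_i w 0 i * (s ^+ j.+1 * 'D_(e_ i) F (segment_point y s))).
  rewrite int01_sum => [|i]; last exact: cont01Z.
  by apply: eq_bigr => i _; rewrite int01Z.
have est (e : R) : 0 < e -> \forall h \near (0 : 'rV[R]_n),
    `|radial_integral j F (h + y) - radial_integral j F y - L' h| <= e * `|h|.
  move=> e0; pose e1 := e / n.+1%:R.
  have e10 : 0 < e1 by rewrite divr_gt0.
  have U1 : \forall h \near (0 : 'rV[R]_n), forall (i : 'I_n) s, 0 <= s <= 1 ->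
      `|'D_(e_ i) F (segment_point (h + y) s) - 'D_(e_ i) F (segment_point y s)| <= e1.
    have FF : Filter (nbhs (0 : 'rV[R]_n)) by exact: nbhs_filter.
    exact: (filter_forall FF (fun i => radial_integral_uniform (DF (e_ i)) yB e10)).
  have U2 : \forall h \near (0 : 'rV[R]_n), B (h + y).
    have : \forall z \near y, B z by exact: open_nbhs_nbhs (conj (ball_open y0 r) yB).
    by rewrite (near_shift 0 y) /= subr0.
  have [d /= d0 dU] := (nbhs_ballP _ _).1 (filterI U1 U2).
  apply/nbhs_ballP; exists d => //= h hd.
  have hdt (t : R) : 0 <= t <= 1 -> ball (0 : 'rV[R]_n) d (t *: h).
    move: hd; rewrite -!ball_normE /ball_/= !sub0r !normrN normrZ => hd /andP[t0 t1].
    by rewrite ger0_norm// (le_lt_trans _ hd)// ler_piMl.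
  have [_ yhB] := dU h hd.
  rewrite /= /L sumE /radial_integral.
  have cu1 := @cont01_seg j F _ cF yhB.
  have cu2 := @cont01_seg j F _ cF yB.
  have cu3 : cont01 (fun s =>
      \sum_i h 0 i * (s ^+ j.+1 * 'D_(e_ i) F (segment_point y s))).
    by apply: cont01_sum => i; exact: cont01Z.
  rewrite -int01B// -int01B//; last exact: cont01B.
  apply: int01_le; first by apply: cont01B => //; exact: cont01B.
  move=> s s01; have /andP[s0 s1] := s01.
  pose g (t : R) : R := F (t *: (s *: h) + segment_point y s).
  have gE t : g t = F (segment_point (t *: h + y) s).
    by rewrite /g segment_pointD scalerA.
  have dg (t : R) : 0 <= t <= 1 ->
      is_derive t (1 : R) g ('D_(s *: h) F (segment_point (t *: h + y) s)).
    move=> t01; rewrite segment_pointD -scalerA; apply: derivable_line; apply: dF.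
    rewrite scalerA -segment_pointD; apply: segment_point_ball => //.
    by case: (dU _ (hdt _ t01)).
  have [||t t01 gD] := @MVT_segment R g (fun t =>
    'D_(s *: h) F (segment_point (t *: h + y) s)) 0 1 ler01.
  - by move=> t; rewrite in_itv/= => /andP[/ltW t0 /ltW t1]; apply: dg; rewrite t0.
  - apply: continuous_in_subspaceT => t; rewrite inE/= in_itv/= => t01.
    by apply/differentiable_continuous/derivable1_diffP; case: (dg t t01).
  have {}t01 : 0 <= t <= 1 by move: t01; rewrite in_itv.
  move: gD; rewrite !gE scale1r scale0r add0r subr0 mulr1.
  have [U1t U2t] := dU _ (hdt _ t01).
  rewrite derive_row; last by apply: dF; exact: segment_point_ball.
  rewrite -mulrBr => ->.
  rewrite mulr_sumr -sumrB (le_trans (ler_norm_sum _ _ _))//.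
  apply: (@le_trans _ _ (\sum_(i < n) (`|h| * e1))).
    apply: ler_sum => i _.
    rewrite mxE -[_ *: _]/(_ * _) exprSr.
    rewrite (_ : _ - _ = s ^+ j * s * (h 0 i *
      ('D_(e_ i) F (segment_point (t *: h + y) s) -
       'D_(e_ i) F (segment_point y s)))); last by rewrite /e_; ring.
    rewrite normrM normrM -[leRHS]mul1r ler_pM//.
      by rewrite -normrM -exprSr ger0_norm ?exprn_ge0// exprn_ile1.
    rewrite normrM ler_pM//; last exact: U1t.
    rewrite [leRHS]mx_normrE; apply: le_trans (le_bigmax _ _ (0, i)) => //=.
  rewrite sumr_const card_ord -mulr_natr -mulrA mulrC ler_wpM2r//.
  rewrite /e1 -mulrA ger_pMr// mulrC ler_pdivrMr// mul1r ler_nat//.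
have [dI dE] := differentiable_estimate cL est.
split=> // w; rewrite deriveE// dE /= /L sumE /radial_integral /int01.
 apply: eq_Rintegral => s; rewrite inE/= in_itv/= => s01.
rewrite derive_row; last by apply: dF; exact: segment_point_ball.
by rewrite mulr_sumr; apply: eq_bigr => i _; rewrite -[_ *: _]/(_ * _) mulrCA.
Qed.

Lemma Ck_radial_integral k j F : smooth_on B F -> Ck k B (radial_integral j F).
Proof.
elim: k j F => [|k IH] j F sF.
  move=> y yB; apply: differentiable_continuous.
  by have [] := radial_integral_differentiable j (sF 1%N) yB.
split=> [y yB|v].
  by have [] := radial_integral_differentiable j (sF 1%N) yB.
have sDF : smooth_on B ('D_v F) by move=> i; have [_ /(_ v)] := sF i.+1.
apply: (Ck_ext (ball_open _ _) _ (IH j.+1 _ sDF)) => y yB.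
by have [_ ->] := radial_integral_differentiable j (sF 1%N) yB.
Qed.

(** The coefficients are the integrals of the partial derivatives of F over the
    segment from y0 to y; the identity is the fundamental theorem of calculus. *)
Lemma hadamard F : 0 < r -> smooth_on B F ->
  exists g : 'I_n -> 'rV[R]_n -> R^o, [/\ forall i, smooth_on B (g i),
    forall i, g i y0 = 'D_(delta_mx 0 i) F y0 &
    forall y, B y -> F y = F y0 + \sum_i (y 0 i - y0 0 i) * g i y].
Proof.
move=> r0 sF; exists (fun i => radial_integral 0 ('D_(delta_mx 0 i) F)).
have sDF i : smooth_on B ('D_(delta_mx 0 i) F).
  by move=> k; have [_ /(_ (delta_mx 0 i))] := sF k.+1.
have dF := (sF 1%N).1.
split=> [i k|i|y yB]; first exact: Ck_radial_integral.
  rewrite /radial_integral (_ : (fun s => _) = cst ('D_(delta_mx 0 i) F y0)).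
    by rewrite /int01 Rintegral_cst//=
    lebesgue_measure_itv/= lte_fin ltr01 oppr0 adde0 mulr1.
  by apply/funext => s; rewrite expr0 mul1r /segment_point subrr scaler0 addr0.
have cu i : cont01 (fun s => s ^+ 0 * 'D_(delta_mx 0 i) F (segment_point y s)).
  exact: (@cont01_seg 0 _ y (sDF i 0%N) yB).
under eq_bigr => i _ do rewrite /radial_integral -int01Z//.
rewrite -int01_sum; last by move=> i; exact/cont01Z.
pose l s : R := F (s *: (y - y0) + y0).
suff -> : int01 (fun s => \sum_i (y 0 i - y0 0 i) *
    (s ^+ 0 * 'D_(delta_mx 0 i) F (segment_point y s))) = l 1 - l 0.
  by rewrite /l scale1r scale0r add0r subrK addrC subrK.
apply: int01_FTC; first by apply: cont01_sum => i; exact/cont01Z.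
move=> s s01; have sB := segment_point_ball s01 yB.
have := @derivable_line F y0 (y - y0) s.
rewrite addrC -/(segment_point y s) => /(_ (dF _ sB)).
move=> dl; apply: is_derive_eq dl _; rewrite derive_row; last exact: dF.
by apply: eq_bigr => i _; rewrite !mxE expr0 mul1r.
Qed.

End Hadamard.

(** * Charts and smooth functions *)

Section ChartTopology.
Variables (R : realType) (n : nat) (T : topologicalType) (c : chart R n T).

Lemma coordV_dom y : img c y -> dom c (coordV c y).
Proof. by move=> [p dp <-]; rewrite coordK. Qed.

Lemma coordVK y : img c y -> coord c (coordV c y) = y.
Proof. by move=> [p dp <-]; rewrite coordK. Qed.

Lemma coord_img p : dom c p -> img c (coord c p).
Proof. by move=> dp; exists p. Qed.

Lemma open_img (U : set T) : open U -> open (coord c @` (dom c `&` U)).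
Proof.
move=> oU; rewrite openE => _ [p [dp Up] <-] /=.
have y_img := coord_img dp.
have nU : nbhs (coord c p) (coordV c @^-1` U).
  by apply: (coordV_cont y_img); rewrite coordK//; exact: open_nbhs_nbhs.
have nI : nbhs (coord c p) (img c).
  by apply: open_nbhs_nbhs; split=> //; exact: img_open.
apply: filterS (filterI nU nI) => y [Uy iy].
by exists (coordV c y); [split=> //; exact: coordV_dom|exact: coordVK].
Qed.

Lemma open_preimage (U : set 'rV[R]_n) : open U -> open (dom c `&` coord c @^-1` U).
Proof.
move=> oU; rewrite openE => p [dp Up] /=.
apply: filterI; first by apply: open_nbhs_nbhs; split=> //; exact: dom_open.
have cc : coord c @ p --> coord c p := coord_cont dp.
by apply: (cc U); by apply: open_nbhs_nbhs.
Qed.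

End ChartTopology.

Section SmoothCriteria.
Variables (R : realType) (n : nat) (M : manifold R n).

(** Smoothness is to hold in every chart of the atlas, but it may be checked near each
    point in one chart, thanks to the compatibility of charts. *)
Lemma smooth_fun_local (f : M -> R^o) :
  (forall p, exists c (U : set 'rV[R]_n), [/\ atlas M c, dom c p, open U,
     U (coord c p) & smooth_on U (f \o coordV c)]) -> smooth_fun f.
Proof.
move=> loc d Md k; apply: Ck_local => _ [p dp <-].
have [c [U [Mc cp oU Up sf]]] := loc p.
pose O := dom c `&` coord c @^-1` U.
have oO : open O by exact: open_preimage.
exists (coord d @` (dom d `&` O)); split.
- exact: open_img.
- by exists p.
have sdc : Ck k (coord d @` (dom d `&` O)) (coord c \o coordV d).
  apply: Ck_sub (atlas_compat Md Mc k) => _ [q [dq [cq _]] <-].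
  by exists q.
have oW := @open_img _ _ _ d _ oO.
apply: (Ck_ext oW _ (Ck_comp oW oU _ sdc (sf k))).
  by move=> _ [q [dq [cq Uq]] <-] /=; rewrite !coordK.
by move=> _ [q [dq [cq Uq]] <-] /=; rewrite coordK.
Qed.

(** The image of K in M is compact, hence closed as M is Hausdorff; off that image the
    extension vanishes near each point, even at points outside the chart. *)
Lemma smooth_zero_extension c (U K : set 'rV[R]_n) (f : 'rV[R]_n -> R^o) :
  atlas M c -> open U -> compact K -> U `<=` img c -> K `<=` U ->
  smooth_on U f -> (forall y, img c y -> ~ K y -> f y = 0) ->
  smooth_fun (fun p => if `[< dom c p >] then f (coord c p) else 0).
Proof.
move=> Mc oU cK Uc KU sf f0; apply: smooth_fun_local => p.
have [[cp Up]|nUp] := pselect (dom c p /\ U (coord c p)).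
  exists c, U; split=> // k; apply: Ck_ext (sf k) => // y Uy /=.
  by rewrite (asboolT (coordV_dom (Uc _ Uy))) coordVK//; exact: Uc.
have KM : closed (coordV c @` K).
  apply: compact_closed (points_hausdorff (m := M)) _.
  apply: continuous_compact cK; apply: continuous_in_subspaceT => y /set_mem Ky.
  by apply: coordV_cont; apply/Uc/KU.
have [d Md dp] := atlas_cover p.
have npK : (~` (coordV c @` K)) p.
  move=> [y Ky yp]; apply: nUp.
  have yc := Uc _ (KU _ Ky); rewrite -yp; split; first exact: coordV_dom.
  by rewrite coordVK//; exact: KU.
have oW := @open_img _ _ _ d _ (closed_openC KM).
exists d, (coord d @` (dom d `&` ~` (coordV c @` K))); split=> //; first by exists p.
move=> k; apply: (Ck_ext oW _ (Ck_cst k _ 0)) => _ [q [dq nq] <-] /=.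
rewrite coordK//; case: asboolP => // cq.
rewrite f0//; first exact: coord_img.
by move=> Kq; apply: nq; exists (coord c q) => //; rewrite coordK.
Qed.

End SmoothCriteria.

Section CinfOps.
Variables (R : realType) (n : nat) (M : manifold R n).
Notation A := (Cinf M).
Implicit Types (f g : A) (p : M).

Lemma Cinf0E p : (0 : A) p = 0. Proof. by []. Qed.
Lemma Cinf1E p : (1 : A) p = 1. Proof. by []. Qed.
Lemma CinfDE f g p : (f + g) p = f p + g p. Proof. by []. Qed.
Lemma CinfNE f p : (- f) p = - f p. Proof. by []. Qed.
Lemma CinfBE f g p : (f - g) p = f p - g p. Proof. by []. Qed.
Lemma CinfME f g p : (f * g) p = f p * g p. Proof. by []. Qed.
Lemma CinfZE (a : R) f p : (a *: f) p = a * f p. Proof. by []. Qed.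
Lemma Cinf_sumE (I : Type) (r : seq I) (P : pred I) (F : I -> A) p :
  (\sum_(i <- r | P i) F i) p = \sum_(i <- r | P i) F i p.
Proof. by elim/big_rec2: _ => // i x y _ <-. Qed.

Definition CinfE := (Cinf0E, Cinf1E, CinfDE, CinfNE, CinfME, CinfZE, Cinf_sumE).

Lemma Cinf_mem f : smooth_fun f.
Proof. by apply/asboolP; exact: Cinf_smooth. Qed.

Definition mkCinf (f : M -> R^o) (sf : smooth_fun f) : A :=
  MkCinf (asboolT sf : f \in @smooth_pred _ _ M).

Lemma Cinf_continuous f : continuous (f : M -> R).
Proof.
move=> p; have [c Mc cp] := atlas_cover p.
have fc : {for p, continuous ((f \o coordV c) \o coord c)}.
  apply: continuous_comp; first exact: coord_cont.
  by apply: (Cinf_mem f Mc 0%N); exact: coord_img.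
have near_f : {near p, (f \o coordV c) \o coord c =1 f}.
  have : nbhs p (dom c) by exact: open_nbhs_nbhs (conj (dom_open c) cp).
  by apply: filterS => q cq /=; rewrite coordK.
rewrite /continuous_at -(nbhs_singleton near_f).
by apply: cvg_trans fc; apply: near_eq_cvg.
Qed.

End CinfOps.

(** * Bump functions and tangent vectors *)

Section Bump.
Variables (R : realType) (n : nat) (M : manifold R n).
Notation A := (Cinf M).

(** A bump function at q in a form made for use with Hadamard's lemma: multiplication by
    chi turns any smooth function of the coordinates on the ball, on which chi is
    supported, into a smooth function on M. *)
Lemma chart_bump c q (V : set M) : atlas M c -> dom c q -> open V -> V q ->
  exists (r : R) (chi : A), [/\ 0 < r, ball (coord c q) r `<=` img c, chi q = 1,
    forall p, chi p != 0 -> [/\ dom c p, V p & ball (coord c q) r (coord c p)] &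
    forall g, smooth_on (ball (coord c q) r) g ->
      exists G : A, forall p, G p = chi p * g (coord c p)].
Proof.
move=> Mc cq oV Vq; set y0 := coord c q.
have oW := @open_img _ _ _ c _ oV.
have nW : nbhs y0 (coord c @` (dom c `&` V)).
  have qW : (coord c @` (dom c `&` V)) y0 by exists q.
  exact: open_nbhs_nbhs (conj oW qW).
have [r /= r0 rW] := (nbhs_ballP _ _).1 nW.
have rimg : ball y0 r `<=` img c by move=> y /rW [p [cp _] <-]; exists p.
pose b := r / 2; have b0 : 0 < b by rewrite divr_gt0.
(* The sup norm is not smooth: the cut-off uses the sum of squares N, and b = r / 2
   leaves room for a compact cube K inside the ball. *)
pose N (y : 'rV[R]_n) : R^o := \sum_i (y 0 i - y0 0 i) * (y 0 i - y0 0 i).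
pose K : set 'rV[R]_n :=
  [set y | forall i, `[y0 0 i - b, y0 0 i + b]%classic (y ord0 i)].
have cK : compact K.
  apply: (@rV_compact R n (fun i => `[y0 0 i - b, y0 0 i + b]%classic)) => i.
  exact: segment_compact.
have Kr : K `<=` ball y0 r.
  move=> y Ky; split=> // i j; rewrite ord1; have := Ky j; rewrite /= in_itv/=.
  move=> /andP[y1 y2]; rewrite -ball_normE /ball_/= ltr_distlC.
  have br : b < r by rewrite /b ltr_pdivrMr// ltr_pMr// ltr1n.
  by apply/andP; split; lra.
pose h0 := flat 0 (b ^+ 2).
have h00 : 0 < h0 by apply: flat_gt0; rewrite exprn_gt0.
pose ch (y : 'rV[R]_n) : R^o := h0^-1 * flat 0 (b ^+ 2 - N y).
have sN : smooth_on (ball y0 r) N.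
  move=> k; apply: Ck_sum (ball_open _ _) _ => i.
  have s1 := CkB (ball_open y0 r) (Ck_coord k i (ball_open y0 r)) (Ck_cst k _ (y0 0 i)).
  by apply: CkM (ball_open _ _) _ _; exact: s1.
have sch : smooth_on (ball y0 r) ch.
  move=> k; apply: CkM (ball_open _ _) (Ck_cst _ _ _) _.
  apply: Ck_flat (ball_open _ _) _.
  exact: CkB (ball_open _ _) (Ck_cst _ _ _) (sN k).
have chK y : ~ K y -> ch y = 0.
  move=> nK; rewrite /ch flat_le0 ?mulr0//.
  rewrite subr_le0 leNgt; apply/negP => Nb; apply: nK => i.
  have : (y 0 i - y0 0 i) * (y 0 i - y0 0 i) < b ^+ 2.
    rewrite (le_lt_trans _ Nb)// /N (bigD1 i)//= lerDl sumr_ge0// => j _.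
    by rewrite -expr2 sqr_ge0.
  rewrite /= in_itv/= -expr2 -ltr_sqrt ?exprn_gt0// !sqrtr_sqr (gtr0_norm b0).
  by rewrite ltr_norml => /andP[? ?]; apply/andP; split; lra.
have ext g : smooth_on (ball y0 r) g -> smooth_fun (M := M)
    (fun p => if `[< dom c p >] then ch (coord c p) * g (coord c p) else 0).
  move=> sg;
  apply: (@smooth_zero_extension _ _ M c (ball y0 r) K (fun y => ch y * g y)) => //.
  - exact: ball_open.
  - by move=> k; apply: CkM (ball_open _ _) (sch k) (sg k).
  - by move=> y _ /chK ->; rewrite mul0r.
pose chi : A := mkCinf (ext (cst 1) (fun k => Ck_cst k _ _)).
have chiE p : chi p = if `[< dom c p >] then ch (coord c p) else 0.
  by rewrite /chi /=; case: ifP; rewrite ?mulr1.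
have chi0 p : chi p != 0 -> dom c p /\ ball y0 r (coord c p).
  rewrite chiE; case: asboolP => [cp|]; last by rewrite eqxx.
  move=> ch0; split=> //; apply: Kr; apply: contrapT => /chK ch0'.
  by move: ch0; rewrite ch0' eqxx.
exists r, chi; split=> //.
- rewrite chiE asboolT// /ch /N big1 ?subr0 ?mulVf ?gt_eqF//.
  by move=> i _; rewrite subrr mul0r.
- move=> p /chi0[cp rp]; split=> //.
  have [p' [cp' Vp'] /(congr1 (coordV c))] := rW _ rp.
  by rewrite !coordK// => <-.
- move=> g sg; exists (mkCinf (ext _ sg)) => p; rewrite chiE /=.
  by case: ifP; rewrite ?mul0r.
Qed.

Lemma smooth_fun_separates (p q : M) : (forall f : A, f p = f q) -> p = q.
Proof.
move=> fpq; apply/eqP; apply: contrapT => /negP pq.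
have [V [oV Vp /negP Vq]] := hausdorff_accessible (points_hausdorff (m := M)) pq.
have [c Mc cp] := atlas_cover p.
have [r [chi [_ _ chip chi0 _]]] := chart_bump Mc cp oV (set_mem Vp).
have : chi q != 0 by rewrite -fpq chip oner_eq0.
by move=> /chi0[_ Vq' _]; apply: Vq; rewrite in_setC => /negP; apply; exact: mem_set.
Qed.

End Bump.

Section TangentVectors.
Variables (R : realType) (n : nat) (M : manifold R n).
Notation A := (Cinf M).
Notation VF := (vector_field M).
Implicit Types (f g : A) (q p : M) (c : chart R n M).

Definition chart_partial c (i : 'I_n) f (y : 'rV[R]_n) : R :=
  'D_(delta_mx 0 i) (f \o coordV c : _ -> R^o) y.

Lemma chart_partial_derivable c f y v : atlas M c -> img c y ->
  derivable (f \o coordV c : _ -> R^o) y v.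
Proof.
by move=> Mc yc; apply: diff_derivable; have [df _] := Cinf_mem f Mc 1%N; exact: df.
Qed.

Lemma chart_partial_smooth c i f : atlas M c ->
  smooth_on (img c) (chart_partial c i f : _ -> R^o).
Proof. by move=> Mc k; have [_ /(_ (delta_mx 0 i))] := Cinf_mem f Mc k.+1. Qed.

Lemma chart_partial_linear c i (a : R) f g y : atlas M c -> img c y ->
  chart_partial c i (a *: f + g) y = a * chart_partial c i f y + chart_partial c i g y.
Proof.
move=> Mc yc; rewrite /chart_partial.
rewrite (_ : _ \o _ = a *: (f \o coordV c : _ -> R^o) + (g \o coordV c : _ -> R^o))//.
have dg := @chart_partial_derivable c g y (delta_mx 0 i) Mc yc.
have df := @chart_partial_derivable c f y (delta_mx 0 i) Mc yc.
by rewrite deriveD ?deriveZ//; exact: derivableZ.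
Qed.

Lemma chart_partial_mul c i f g y : atlas M c -> img c y ->
  chart_partial c i (f * g) y =
    chart_partial c i f y * g (coordV c y) + f (coordV c y) * chart_partial c i g y.
Proof.
move=> Mc yc; rewrite /chart_partial.
rewrite (_ : _ \o _ = (f \o coordV c : _ -> R) * (g \o coordV c : _ -> R))//.
have dg := @chart_partial_derivable c g y (delta_mx 0 i) Mc yc.
have df := @chart_partial_derivable c f y (delta_mx 0 i) Mc yc.
by rewrite deriveM//= addrC -![_ *: _]/(_ * _) [X in X + _]mulrC.
Qed.

Lemma chart_partial_tangent c i q : atlas M c -> dom c q ->
  tangent_vector q (fun f => chart_partial c i f (coord c q)).
Proof.
move=> Mc cq; have yc := coord_img cq; split=> [a f g|f g].
  exact: chart_partial_linear.
by rewrite chart_partial_mul// coordK.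
Qed.

Section AtPoint.
Variables (q : M) (v : A -> R).
Hypothesis tv : tangent_vector q v.

Lemma tangentD f g : v (f + g) = v f + v g.
Proof. by have := tv.1 1 f g; rewrite scale1r mul1r. Qed.
Lemma tangent0 : v 0 = 0.
Proof. by apply: (addrI (v 0)); rewrite -tangentD !addr0. Qed.
Lemma tangentZ a f : v (a *: f) = a * v f.
Proof. by have := tv.1 a f 0; rewrite tangent0 !addr0. Qed.
Lemma tangentN f : v (- f) = - v f.
Proof. by rewrite -scaleN1r tangentZ mulN1r. Qed.
Lemma tangentB f g : v (f - g) = v f - v g.
Proof. by rewrite tangentD tangentN. Qed.
Lemma tangent1 : v 1 = 0.
Proof.
have := tv.2 1 1; rewrite mulr1 Cinf1E mulr1 mul1r => v1.
by apply: (addrI (v 1)); rewrite -v1 addr0.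
Qed.
Lemma tangent_sum m (F : 'I_m -> A) : v (\sum_i F i) = \sum_i v (F i).
Proof. exact: (big_morph v tangentD tangent0). Qed.

(** A tangent vector only sees the first-order part of a function.  With chi a bump
    function, Hadamard's lemma writes chi^2 (f - f q) as a sum of products of two
    smooth functions vanishing at q, and v kills such products. *)
Lemma tangent_first_order c f : atlas M c -> dom c q ->
  (forall i, chart_partial c i f (coord c q) = 0) -> v f = 0.
Proof.
move=> Mc cq f0; have [r [chi [r0 rc chiq chi0 chi_ext]]] := chart_bump Mc cq openT I.
set y0 := coord c q in r0 rc chi0 chi_ext f0.
have sf : smooth_on (ball y0 r) (f \o coordV c : _ -> R^o).
  by move=> k; apply: Ck_sub rc (Cinf_mem f Mc k).
have [g [sg g0 fE]] := hadamard r0 sf.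
have sx (i : 'I_n) : smooth_on (ball y0 r) (fun y : 'rV[R]_n => y 0 i - y0 0 i : R^o).
  by move=> k; exact: CkB (ball_open _ _) (Ck_coord _ _ (ball_open _ _)) (Ck_cst _ _ _).
have /choice[X XE] := fun i => chi_ext _ (sx i).
have /choice[G GE] := fun i => chi_ext _ (sg i).
have E : chi * chi * (f - (f q : R) *: (1 : A)) = \sum_i X i * G i.
  apply: CinfP => p; rewrite !CinfE.
  under [RHS]eq_bigr => i _ do rewrite CinfME XE GE.
  have [->|/chi0[cp _ bp]] := eqVneq (chi p) 0.
    by rewrite !mul0r big1// => i _; rewrite !mul0r.
  have := fE _ bp; rewrite /= coordK// /y0 coordK// => ->.
  rewrite mulr1 [X in _ * X]addrAC subrr add0r mulr_sumr; apply: eq_bigr => i _.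
  by rewrite mulrACA.
have := congr1 v E; rewrite tangent_sum big1 => [|i _]; last first.
  rewrite tv.2 XE GE -/y0 g0 -/(chart_partial c i f y0) f0 subrr.
  by rewrite !mulr0 mul0r addr0.
rewrite tv.2 tangentB tangentZ tangent1 !CinfE chiq mulr0 subr0 !mul1r mulr1.
by rewrite subrr mulr0 add0r.
Qed.

End AtPoint.
End TangentVectors.

(** * Local frames and division of vector fields *)

Section Frames.
Variables (R : realType) (n : nat) (M : manifold R n).
Notation A := (Cinf M).
Notation VF := (vector_field M).
Implicit Types (f g h : A) (V X Y : VF) (p q : M).

Lemma vfDE X Y f : (X + Y) f = X f + Y f. Proof. by []. Qed.
Lemma vfNE X f : (- X) f = - X f. Proof. by []. Qed.
Lemma vfZE h X f : (h *: X) f = h * X f. Proof. by []. Qed.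
Lemma lieE X Y f : lie X Y f = X (Y f) - Y (X f). Proof. by []. Qed.

Lemma vf_sumE (I : Type) (r : seq I) (P : pred I) (F : I -> VF) f :
  (\sum_(i <- r | P i) F i) f = \sum_(i <- r | P i) F i f.
Proof. by elim/big_rec2: _ => // i x y _ <-. Qed.

Lemma vf_tangent V q : tangent_vector q (fun f => V f q).
Proof.
by split=> [a f g|f g]; rewrite ?(vf_derivation V).1 ?(vf_derivation V).2.
Qed.

Lemma derive_coord (i j : 'I_n) (y w : 'rV[R]_n) :
  is_derive y w (fun y : 'rV[R]_n => y 0 i : R^o) (w 0 i).
Proof.
apply: DeriveDef; first exact/diff_derivable/differentiable_coord.
have := derive_id y w => /(congr1 (fun m : 'rV[R]_n => m 0 i)).
by rewrite derive_mx// mxE.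
Qed.

(** Any vector field is near p a combination of the same n fields.  With
    xi_i = chi (x_i - x_i(p)) and E_i = chi d_i, the identity
      chi^3 V = sum_i (chi V(xi_i) - xi_i V(chi)) E_i
    holds on all of M, so that it can be fed to forms, which are multilinear over
    global functions only; at p the coefficients are just V(xi_i). *)
Lemma local_frame p : exists (E : 'I_n -> VF) (xi : 'I_n -> A) (e : A), e p = 1 /\
  forall V, exists a : 'I_n -> A,
    (forall i, a i p = V (xi i) p) /\ e *: V = \sum_i a i *: E i.
Proof.
have [c Mc cp] := atlas_cover p.
have [r [chi [r0 rc chip chi0 chi_ext]]] := chart_bump Mc cp openT I.
set y0 := coord c p in r0 rc chi0 chi_ext.
have sx (i : 'I_n) : smooth_on (ball y0 r) (fun y : 'rV[R]_n => y 0 i - y0 0 i : R^o).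
  by move=> k; exact: CkB (ball_open _ _) (Ck_coord _ _ (ball_open _ _)) (Ck_cst _ _ _).
have /choice[xi xiE] := fun i => chi_ext _ (sx i).
have spd (w : 'I_n * A) :
    smooth_on (ball y0 r) (chart_partial c w.1 w.2 : _ -> R^o).
  by move=> k; apply: Ck_sub rc (chart_partial_smooth _ _ Mc k).
have /choice[G GE] := fun w => chi_ext _ (spd w).
have derG i : derivation (fun f => G (i, f)).
  split=> [a f g|f g]; apply: CinfP => q; rewrite !CinfE !GE /=.
    have [->|/chi0[cq _ _]] := eqVneq (chi q) 0; first by rewrite !mul0r mulr0 addr0.
    by rewrite chart_partial_linear//; [ring|exact: coord_img].
  have [->|/chi0[cq _ _]] := eqVneq (chi q) 0; first by rewrite !mul0r mulr0 addr0.
  by rewrite chart_partial_mul//; [rewrite coordK//; ring|exact: coord_img].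
exists (fun i => VectorField (derG i)), xi, (chi * chi * chi).
split; first by rewrite !CinfE chip !mulr1.
move=> V; exists (fun i => chi * V (xi i) - xi i * V chi); split.
  by move=> i; rewrite !CinfE xiE -/y0 chip subrr mulr0 mul0r subr0 mul1r.
apply: vfP => f; rewrite vf_sumE; apply: CinfP => q.
rewrite vfZE !CinfE.
rewrite (eq_bigr (fun i : 'I_n => (chi q * V (xi i) q -
    chi q * (coord c q 0 i - y0 0 i) * V chi q) *
    (chi q * chart_partial c i f (coord c q)))); last first.
  by move=> i _; rewrite -xiE -(GE (i, f)).
have [->|chiq] := eqVneq (chi q) 0.
  by rewrite !mul0r big1// => i _; rewrite !mul0r mulr0.
have [cq _ _] := chi0 q chiq; set y := coord c q.
have yc : img c y by exact: coord_img.
pose d i : R := chart_partial c i f y.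
(* phi has zero differential at q: it is chi(q) f minus its linear part, expressed
   with global functions.  So V phi q = 0, which is the claim divided by chi(q)^2. *)
pose phi : A := chi q *: f - \sum_i d i *: (xi i - (y 0 i - y0 0 i) *: chi).
have tV := vf_tangent V q.
have tpd i := chart_partial_tangent i Mc cq.
have d_xi i j : chart_partial c j (xi i) y =
    chart_partial c j chi y * (y 0 i - y0 0 i) + chi q * (i == j)%:R.
  pose x (z : 'rV[R]_n) : R^o := z 0 i - y0 0 i.
  have dx : is_derive y (delta_mx 0 j) x (i == j)%:R.
    have H := is_deriveB (derive_coord i j y (delta_mx 0 j))
      (is_derive_cst (y0 0 i : R^o) y (delta_mx 0 j)).
    by apply: (is_derive_eq (f := x) H); rewrite mxE eqxx/= subr0.
  have dchi := derivableP (@chart_partial_derivable _ _ _ c chi y (delta_mx 0 j) Mc yc).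
  rewrite /chart_partial.
  have : \forall z \near y, (xi i \o coordV c) z =
      ((chi \o coordV c : _ -> R) * x) z.
    have : nbhs y (img c) by apply: open_nbhs_nbhs; split=> //; exact: img_open.
    by apply: filterS => z zc /=; rewrite xiE coordVK.
  move=> /near_eq_derive ->.
  rewrite (@derive_val _ _ _ _ _ _ _ (is_deriveM dchi dx)) /= coordK//.
  by rewrite addrC -![_ *: _]/(_ * _) [X in X + _]mulrC.
have phi0 : V phi q = 0.
  apply: (tangent_first_order tV Mc cq) => j; rewrite /phi.
  rewrite (tangentB (tpd j)) (tangentZ (tpd j)) (tangent_sum (tpd j)).
  under eq_bigr => i _ do
    rewrite (tangentZ (tpd j)) (tangentB (tpd j)) (tangentZ (tpd j)) d_xi
      [X in _ * (X - _)]addrC mulrC [X in _ - X]mulrC addrK.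
  rewrite (bigD1 j)//= eqxx mulr1 big1 ?addr0 ?subrr// => i /negbTE ->.
  by rewrite mulr0 mul0r.
move: phi0; rewrite /phi (tangentB tV) (tangentZ tV) (tangent_sum tV) /=.
under eq_bigr => i _ do rewrite (tangentZ tV) (tangentB tV) (tangentZ tV).
move=> /eqP; rewrite subr_eq0 => /eqP Vf.
rewrite -mulrA Vf mulr_sumr; apply: eq_bigr => i _; rewrite -/y -/(d i); ring.
Qed.

(** The hypothesis says that Y and X are proportional at each point, the factor at p
    being Y g p / X g p for any g with X g p <> 0.  Since the same g serves near p, the factor
    is smooth. *)
Lemma Cinf_divide X Y : (forall p, exists g, X g p != 0) ->
  (forall f g, Y f * X g = Y g * X f) -> exists h : A, Y = h *: X.
Proof.
move=> /choice[g gp] YX.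
pose h p : R^o := Y (g p) p / X (g p) p.
have hE p f : Y f p = h p * X f p.
  rewrite /h mulrAC; apply: (mulIf (gp p)); rewrite divfK//.
  by have := congr1 (fun u : A => u p) (YX f (g p)).
have sh : smooth_fun h.
  apply: smooth_fun_local => p; have [c Mc cp] := atlas_cover p.
  pose O := [set q | X (g p) q != 0].
  have oO : open O.
    have -> : O = X (g p) @^-1` [set t : R | t != 0] by [].
    by apply: open_comp; [move=> q _; exact: Cinf_continuous|exact: open_neq].
  exists c, (coord c @` (dom c `&` O)); split=> //.
  - exact: open_img.
  - by exists p => //; split=> //; exact: gp.
  have oW := @open_img _ _ _ c _ oO.
  have Wc : coord c @` (dom c `&` O) `<=` img c.
    by move=> _ [q [cq _] <-]; exact: coord_img.
  move=> k; have sY := Ck_sub Wc (Cinf_mem (Y (g p)) Mc k).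
  have sX := Ck_sub Wc (Cinf_mem (X (g p)) Mc k).
  apply: (Ck_ext oW _ (CkM oW sY (CkV oW _ sX))).
    move=> _ [q [cq Oq] <-] /=; rewrite coordK//.
    by rewrite hE mulfK.
  by move=> _ [q [cq Oq] <-] /=; rewrite coordK.
exists (mkCinf sh); apply: vfP => f; apply: CinfP => p; exact: hE.
Qed.

End Frames.

(** * Alternating forms and uniqueness of the modular field *)

Section AlternatingForms.
Variables (R : realType) (n : nat) (M : manifold R n).
Notation A := (Cinf M).
Notation VF := (vector_field M).

Section OneForm.
Variables (k : nat) (alpha : preform M k).
Hypothesis alpha_form : is_form alpha.
Implicit Types (Y : 'I_k -> VF) (X V : VF) (i j : 'I_k).

Lemma form_add Y i X X' :
  alpha [eta Y with i |-> X + X'] =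
    alpha [eta Y with i |-> X] + alpha [eta Y with i |-> X'].
Proof. by have := alpha_form.1 Y i 1 X X'; rewrite scale1r mul1r. Qed.

Lemma form_zero Y i : alpha [eta Y with i |-> 0] = 0.
Proof. by apply: (addrI (alpha [eta Y with i |-> 0])); rewrite -form_add !addr0. Qed.

Lemma form_scale Y i (f : A) X :
  alpha [eta Y with i |-> f *: X] = f * alpha [eta Y with i |-> X].
Proof. by have := alpha_form.1 Y i f X 0; rewrite form_zero !addr0. Qed.

Lemma form_sum Y i m (X : 'I_m -> VF) :
  alpha [eta Y with i |-> \sum_j X j] = \sum_j alpha [eta Y with i |-> X j].
Proof.
exact: (big_morph (fun X => alpha [eta Y with i |-> X]) (form_add Y i) (form_zero Y i)).
Qed.

Lemma with_id Y i : [eta Y with i |-> Y i] = Y :> ('I_k -> VF).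
Proof. by apply/funext => l /=; case: eqP => [->|]. Qed.

Lemma with_comm Y i j X X' : i != j ->
  [eta [eta Y with j |-> X'] with i |-> X] =
  [eta [eta Y with i |-> X] with j |-> X'] :> ('I_k -> VF).
Proof.
move=> ij; apply/funext => l /=; case: eqP => [->|//].
by rewrite (negbTE ij).
Qed.

Lemma form_swap Y i j X X' : i != j ->
  alpha [eta [eta Y with j |-> X'] with i |-> X] =
  - alpha [eta [eta Y with j |-> X] with i |-> X'].
Proof.
move=> ij; apply/eqP; rewrite -addr_eq0; apply/eqP.
have alt V : alpha [eta [eta Y with j |-> V] with i |-> V] = 0.
  by apply: (alpha_form.2 _ i j ij); rewrite /= eqxx eq_sym (negbTE ij) eqxx.
have := alt (X + X'); rewrite form_add 2!(with_comm _ _ _ ij) !form_add.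
by rewrite -!(with_comm _ _ _ ij) !alt add0r addr0 addrC.
Qed.

(** At p a form only sees the values V (xi j) p, which is the tensoriality of forms. *)
Lemma form_frame p (E : 'I_n -> VF) (xi : 'I_n -> A) (e : A) V (a : 'I_n -> A) Y i :
  e p = 1 -> (forall j : 'I_n, a j p = V (xi j) p) -> e *: V = \sum_i a i *: E i ->
  alpha [eta Y with i |-> V] p = \sum_j V (xi j) p * alpha [eta Y with i |-> E j] p.
Proof.
move=> ep ap eV; rewrite -[LHS]mul1r -ep -CinfME -form_scale eV form_sum Cinf_sumE.
by apply: eq_bigr => j _; rewrite form_scale CinfME ap.
Qed.

End OneForm.

Lemma iprod_zero_slot k (alpha : preform M k.+1) V Y i : is_form alpha ->
  iprod V alpha = (fun=> 0) -> alpha [eta Y with i |-> V] = 0.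
Proof.
move=> fa aV.
have a0 (Z : 'I_k.+1 -> VF) : alpha [eta Z with ord0 |-> V] = 0.
  rewrite -(congr1 (fun b => b (Z \o lift ord0)) aV); congr alpha.
  apply/funext => l; rewrite /fcons /=; case: unliftP => [j ->|->].
    by rewrite eq_sym (negbTE (neq_lift _ _)).
  by rewrite eqxx.
have [->//|i0] := eqVneq i ord0.
rewrite -(with_id [eta Y with i |-> V] ord0) (form_swap fa); last by rewrite eq_sym.
by rewrite a0 oppr0.
Qed.

End AlternatingForms.

Section Contraction.
Variables (R : realType) (n : nat) (M : manifold R n).
Notation A := (Cinf M).
Notation VF := (vector_field M).

(** Expanding both arguments in a local frame, the antisymmetry of alpha replaces the
    products Y(xi_i) X(xi_j) by the brackets (X /\ Y)(xi_j, xi_i). *)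
Lemma iprod_wedge k (alpha : preform M k.+2) (X Y X' Y' : VF) : is_form alpha ->
  wedge X Y = wedge X' Y' ->
  iprod X (iprod Y alpha) = iprod X' (iprod Y' alpha).
Proof.
move=> fa XY; apply/funext => Z; apply: CinfP => p.
have [E [xi [e [ep frame]]]] := local_frame p.
pose o1 : 'I_k.+2 := lift ord0 ord0.
have o01 : ord0 != o1 by exact: neq_lift.
have fconsE (U V : VF) :
    fcons V (fcons U Z) =
    [eta [eta fcons 0 (fcons 0 Z) with o1 |-> U] with ord0 |-> V] :> (_ -> VF).
  apply/funext => l; rewrite /fcons /=; case: unliftP => [j ->|->//].
  rewrite eq_sym (negbTE (neq_lift _ _)) (inj_eq (@lift_inj _ _)).
  case: unliftP => [j' ->|->]; last by rewrite eqxx.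
  by rewrite eq_sym (negbTE (neq_lift _ _)).
pose B i j := alpha (fcons (E i) (fcons (E j) Z)) p.
have B_anti i j : B i j = - B j i.
  by rewrite /B (fconsE (E j) (E i)) (fconsE (E i) (E j))
    (form_swap fa _ _ _ o01) CinfNE.
have expand (U V : VF) : iprod U (iprod V alpha) Z p =
    \sum_i \sum_j V (xi i) p * U (xi j) p * B i j.
  have [a [ap aV]] := frame V; have [b [bp bU]] := frame U.
  rewrite /iprod (fconsE U V) (form_frame fa _ _ ep ap aV); apply: eq_bigr => i _.
  rewrite (with_comm _ _ _ o01) (form_frame fa _ _ ep bp bU) mulr_sumr.
  by apply: eq_bigr => j _; rewrite mulrA -(with_comm _ _ _ o01) -(fconsE (E j) (E i)).
(* Adding the expansion to itself with i and j exchanged brings in the bracket. *)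
have twice (U V : VF) : iprod U (iprod V alpha) Z p + iprod U (iprod V alpha) Z p =
    \sum_i \sum_j wedge U V (xi j) (xi i) p * B i j.
  rewrite {2}expand exchange_big expand -big_split; apply: eq_bigr => i _.
  rewrite -big_split; apply: eq_bigr => j _.
  by rewrite [B j i]B_anti /wedge CinfBE !CinfME /=; ring.
have := twice X Y; rewrite XY -twice -!mulr2n => /eqP.
by rewrite -subr_eq0 -mulrnBl mulrn_eq0 /= subr_eq0 => /eqP.
Qed.

End Contraction.

Section VolumeForms.
Variables (R : realType) (n : nat) (M : manifold R n.+1) (omega : preform M n.+1).
Hypothesis omega_vol : volume_form omega.
Notation A := (Cinf M).
Notation VF := (vector_field M).

(** Some arrangement of the fields of a local frame has nonzero volume at p.  Replacing
    one of them by V gives the corresponding coordinate of V times that volume, and zero by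
    assumption. *)
Lemma volume_nondegenerate (V : VF) : iprod V omega = (fun=> 0) -> V = 0.
Proof.
have [fo nz] := omega_vol; move=> iV; apply: vfP => f; apply: CinfP => p.
have [E [xi [e [ep frame]]]] := local_frame p.
have [a [ap aV]] := frame V.
suff Vxi i : V (xi i) p = 0.
  have := congr1 (fun U : VF => U f p) aV; rewrite vfZE vf_sumE CinfME ep mul1r => ->.
  by rewrite Cinf_sumE big1// => i _; rewrite vfZE CinfME ap Vxi mul0r.
have [Y Yp] := nz p.
(* The members of Y are replaced one after the other by frame fields. *)
have [s sp] : exists s : 'I_n.+1 -> 'I_n.+1, omega (E \o s) p != 0.
  suff /(_ n.+1 (leqnn _)) [s sp] : forall m, (m <= n.+1)%N ->
      exists s : 'I_n.+1 -> 'I_n.+1,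
        omega (fun l => if (l < m)%N then E (s l) else Y l) p != 0.
    exists s; rewrite (_ : _ \o _ =
      fun l : 'I_n.+1 => if (l < n.+1)%N then E (s l) else Y l)//.
    by apply/funext => l; rewrite ltn_ord.
  elim=> [|m IH] mn; first by exists id.
  have [s sp] := IH (ltnW mn); pose o := Ordinal mn.
  have [b [bp bY]] := frame (Y o).
  move: sp; set W := (fun l => _) => sp.
  have Wo : W = [eta W with o |-> Y o] :> (_ -> VF).
    by apply/funext => l /=; case: eqP => // ->; rewrite /W ltnn.
  move: sp; rewrite Wo (form_frame fo _ _ ep bp bY) => sp.
  have [j jp] : exists j, omega [eta W with o |-> E j] p != 0.
    apply: contrapT => no; move: sp; rewrite big1 ?eqxx// => j _.
    have [->|nj] := eqVneq (omega [eta W with o |-> E j] p) 0; first by rewrite mulr0.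
    by case: no; exists j.
  exists (fun l => if l == o then j else s l).
  rewrite (_ : (fun l => _) = [eta W with o |-> E j] :> (_ -> VF))//.
  apply/funext => l /=; rewrite /W ltnS leq_eqVlt -(inj_eq val_inj) /=.
  by case: eqP => //= ->; rewrite ltnn.
have s_inj : injective s.
  move=> l l' sl; apply/eqP; apply: contraT => ll'.
  by move: sp; rewrite (fo.2 _ l l' ll') ?eqxx//= sl.
have [k sk] : exists k, s k = i by exists (invF s_inj i); rewrite f_invF.
have := iprod_zero_slot (E \o s) k fo iV => /(congr1 (fun u : A => u p)) /=.
rewrite (form_frame fo _ _ ep ap aV) (bigD1 i)//= big1 ?addr0; last first.
  move=> j ji; have [l sl] : exists l, s l = j by exists (invF s_inj j); rewrite f_invF.
  rewrite (fo.2 _ k l) ?mulr0//= ?eqxx.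
    by apply: contraNneq ji => kl; rewrite -sl -kl sk.
  by case: eqP => // _; rewrite sl.
by rewrite -sk with_id => /eqP; rewrite mulf_eq0 (negbTE sp) orbF => /eqP.
Qed.

End VolumeForms.

Lemma modular_field_unique (R : realType) n (M : manifold R n.+2)
    (omega : preform M n.+2) (P : bivector M) (Xi Xi' : vector_field M) :
  volume_form omega -> modular_field omega P Xi -> modular_field omega P Xi' ->
  Xi = Xi'.
Proof.
move=> vol [X [Y [PXY dXY]]] [X' [Y' [PXY' dXY']]].
apply/eqP; rewrite -subr_eq0; apply/eqP; apply: (volume_nondegenerate vol).
have E : iprod Xi omega = iprod Xi' omega.
  by rewrite dXY dXY'; congr ext_d; apply: (iprod_wedge vol.1); rewrite -PXY.
apply/funext => Z; have fconsE V : fcons V Z =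
    [eta fcons 0 Z with ord0 |-> V] :> (_ -> vector_field M).
  apply/funext => l; rewrite /fcons /=; case: unliftP => [j ->|->//].
  by rewrite eq_sym (negbTE (neq_lift _ _)).
have := congr1 (fun b => b Z) E.
rewrite /iprod (fconsE Xi) (fconsE Xi') (fconsE (Xi - Xi')) => EZ.
rewrite (form_add vol.1) EZ -scaleN1r (form_scale vol.1) mulN1r.
by rewrite subrr.
Qed.

(** * Change of the normalised fields *)

Section VectorFieldAlgebra.
Variables (R : realType) (n : nat) (M : manifold R n).
Notation A := (Cinf M).
Notation VF := (vector_field M).
Implicit Types (f g h : A) (X Y Z : VF).

Lemma vf_add X f g : X (f + g) = X f + X g.
Proof. by have := (vf_derivation X).1 1 f g; rewrite !scale1r. Qed.
Lemma vf_zero X : X 0 = 0.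
Proof. by apply: (addrI (X 0)); rewrite -vf_add !addr0. Qed.
Lemma vf_opp X f : X (- f) = - X f.
Proof. by apply: (addrI (X f)); rewrite -vf_add !subrr vf_zero. Qed.
Lemma vf_mul X f g : X (f * g) = X f * g + f * X g.
Proof. exact: (vf_derivation X).2. Qed.

Lemma lin_indep_neq0 X Y : lin_indep X Y ->
  (forall p, exists g, X g p != 0) /\ (forall p, exists g, Y g p != 0).
Proof.
move=> ind; split=> p; apply: contrapT => no.
  have [|/eqP] := ind p 1 0; last by rewrite oner_eq0.
  move=> f; rewrite mul1r mul0r addr0; apply/eqP; apply: contrapT => /negP nz.
  by apply: no; exists f.
have [|_ /eqP] := ind p 0 1; last by rewrite oner_eq0.
move=> f; rewrite mul1r mul0r add0r; apply/eqP; apply: contrapT => /negP nz.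
by apply: no; exists f.
Qed.

Lemma lin_indep_coef X Y (g h : A) : lin_indep X Y ->
  (forall f, g * X f + h * Y f = 0) -> g = 0 /\ h = 0.
Proof.
move=> ind gh; split; apply: CinfP => p; have [] := ind p (g p) (h p) => //.
all: by move=> f; have := congr1 (fun u : A => u p) (gh f).
Qed.

Lemma wedge_same_left X X' Y : (forall p, exists g, Y g p != 0) ->
  wedge X Y = wedge X' Y -> exists g : A, X' = X + g *: Y.
Proof.
move=> Y0 XY; have [|g gE] := @Cinf_divide _ _ _ Y (X' - X) Y0; last first.
  by exists g; rewrite -gE addrC subrK.
move=> f h; have := congr1 (fun b => b f h) XY; rewrite /wedge => E.
apply/eqP; rewrite -subr_eq0 !vfDE !vfNE; apply/eqP.
transitivity ((X' f * Y h - Y f * X' h) - (X f * Y h - Y f * X h)); first by ring.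
by rewrite E subrr.
Qed.

End VectorFieldAlgebra.

Section Gauge.
Variables (R : realType) (n : nat) (M : manifold R n.+2).
Notation A := (Cinf M).
Notation VF := (vector_field M).
Variables (X1 X2 Xi1 Xi2 : VF) (lambda mu1 mu2 : A).
Variables (g1 g2 lambda' mu1' mu2' : A).
Hypothesis ind : lin_indep Xi1 Xi2.
Hypotheses (Xi12 : lie Xi1 Xi2 = 0) (X1Xi1 : lie X1 Xi1 = 0) (X2Xi2 : lie X2 Xi2 = 0).
Hypothesis str : structure_equations X1 Xi1 X2 Xi2 0 0 lambda mu1 mu2.
Let X1' := X1 + g1 *: Xi1.
Let X2' := X2 + g2 *: Xi2.
Hypotheses (X1Xi1' : lie X1' Xi1 = 0) (X2Xi2' : lie X2' Xi2 = 0).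
Hypothesis str' : structure_equations X1' Xi1 X2' Xi2 0 0 lambda' mu1' mu2'.

Let comm12 f : Xi1 (Xi2 f) = Xi2 (Xi1 f).
Proof. by have := congr1 (fun V : VF => V f) Xi12; rewrite lieE => /subr0_eq. Qed.
Let comm1 f : X1 (Xi1 f) = Xi1 (X1 f).
Proof. by have := congr1 (fun V : VF => V f) X1Xi1; rewrite lieE => /subr0_eq. Qed.
Let comm2 f : X2 (Xi2 f) = Xi2 (X2 f).
Proof. by have := congr1 (fun V : VF => V f) X2Xi2; rewrite lieE => /subr0_eq. Qed.

Let str1 f : X1 (Xi2 f) = lambda * Xi2 f + Xi2 (X1 f).
Proof.
have [E _ _] := str; have /eqP := congr1 (fun V : VF => V f) E.
by rewrite lieE vfDE !vfZE mul0r add0r subr_eq => /eqP.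
Qed.
Let str2 f : X2 (Xi1 f) = lambda * Xi1 f + Xi1 (X2 f).
Proof.
have [_ E _] := str; have /eqP := congr1 (fun V : VF => V f) E.
by rewrite lieE vfDE !vfZE mul0r addr0 subr_eq => /eqP.
Qed.
Let str3 f : X1 (X2 f) =
  lambda * (X1 f - X2 f) + mu1 * Xi1 f - mu2 * Xi2 f + X2 (X1 f).
Proof.
have [_ _ E] := str; have /eqP := congr1 (fun V : VF => V f) E.
by rewrite lieE vfDE !vfNE vfDE !vfZE vfDE vfNE subr_eq => /eqP.
Qed.

(** [X_i + g_i Xi_i, Xi_i] differs from [X_i, Xi_i] by - Xi_i(g_i) Xi_i. *)
Lemma gauge_diag : Xi1 g1 = 0 /\ Xi2 g2 = 0.
Proof.
have [n1 n2] := lin_indep_neq0 ind; split; apply: CinfP => p.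
  have [f fp] := n1 p; have := congr1 (fun V : VF => V f) X1Xi1'.
  rewrite lieE !vfDE !vfZE vf_add vf_mul comm1 => E; apply/eqP.
  have : Xi1 g1 * Xi1 f = 0 by rewrite -[RHS]oppr0 -[X in - X]/((0 : VF) f) -E; ring.
  by move=> /(congr1 (fun u : A => u p)); rewrite CinfME => /eqP;
  rewrite mulf_eq0 (negbTE fp) orbF.
have [f fp] := n2 p; have := congr1 (fun V : VF => V f) X2Xi2'.
rewrite lieE !vfDE !vfZE vf_add vf_mul comm2 => E; apply/eqP.
have : Xi2 g2 * Xi2 f = 0 by rewrite -[RHS]oppr0 -[X in - X]/((0 : VF) f) -E; ring.
by move=> /(congr1 (fun u : A => u p)); rewrite CinfME => /eqP;
  rewrite mulf_eq0 (negbTE fp) orbF.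
Qed.

(** Compares the coefficients of [X1', Xi2] = lambda Xi2 - Xi2(g1) Xi1 and of
    [X2', Xi1] = lambda Xi1 - Xi1(g2) Xi2 with the normal form. *)
Lemma gauge_cross : [/\ lambda' = lambda, Xi2 g1 = 0 & Xi1 g2 = 0].
Proof.
have [E1 E2 _] := str'.
have [e1 e2] : Xi2 g1 = 0 /\ lambda' - lambda = 0.
  apply: (lin_indep_coef ind) => f.
  have := congr1 (fun V : VF => V f) E1.
  rewrite lieE !vfDE !vfZE vf_add vf_mul str1 comm12 => E.
  by move: E => /esym/eqP; rewrite -subr_eq0 => /eqP <-; ring.
have [e3 _] : Xi1 g2 = 0 /\ (0 : A) = 0.
  have [|_ ->//] := @lin_indep_coef _ _ _ Xi1 Xi2 (lambda' - lambda) (Xi1 g2) ind.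
  move=> f; have := congr1 (fun V : VF => V f) E2.
  rewrite lieE !vfDE !vfZE vf_add vf_mul str2 -comm12 => E.
  by move: E => /esym/eqP; rewrite -subr_eq0 => /eqP <-; ring.
by split=> //; apply: subr0_eq.
Qed.

(** Expanding [X1', X2'] gives mu1' = mu1 - X2 g1 - 2 lambda g1 and
    mu2' = mu2 - X1 g2 - 2 lambda g2, where X2 g1 is killed by Xi1 since X2 maps
    functions killed by Xi1 to functions killed by Xi1. *)
Lemma gauge_mu : Xi1 lambda = 0 -> Xi2 lambda = 0 ->
  Xi1 mu1' = Xi1 mu1 /\ Xi2 mu2' = Xi2 mu2.
Proof.
move=> l1 l2; have [d1 d2] := gauge_diag; have [ll c1 c2] := gauge_cross.
have [_ _ E3] := str'; rewrite ll in E3.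
have [m1 m2] : mu1' - (mu1 - (X2 g1 + lambda * g1 + lambda * g1)) = 0 /\
    (mu2 - (X1 g2 + lambda * g2 + lambda * g2)) - mu2' = 0.
  apply: (lin_indep_coef ind) => f; have := congr1 (fun V : VF => V f) E3.
  rewrite lieE !(vfDE, vfNE, vfZE) !(vf_add, vf_mul) str1 str2 str3 c1 c2 comm12 => E.
  by move: E => /esym/eqP; rewrite -subr_eq0 => /eqP <-; ring.
have -> : mu1' = mu1 - (X2 g1 + lambda * g1 + lambda * g1) by exact: subr0_eq.
have -> : mu2' = mu2 - (X1 g2 + lambda * g2 + lambda * g2) by rewrite (subr0_eq m2).
have s1 : Xi1 (X2 g1) = 0.
  by have := str2 g1; rewrite d1 vf_zero mulr0 add0r.
have s2 : Xi2 (X1 g2) = 0.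
  by have := str1 g2; rewrite d2 vf_zero mulr0 add0r.
rewrite !(vf_add, vf_opp, vf_mul) s1 s2 l1 l2 d1 d2; split; ring.
Qed.

End Gauge.

(** * Smooth maps and uniqueness of the base data *)

Section SmoothMaps.
Variables (R : realType).

Lemma open_comp_continuous (S T : topologicalType) (F : S -> T) (U : set T) :
  continuous F -> open U -> open (F @^-1` U).
Proof. by move=> cF oU; apply: open_comp => // x _; exact: cF. Qed.

Lemma smooth_fun_comp m n (M : manifold R m) (N : manifold R n) (F : M -> N)
    (f : N -> R^o) : smooth_map F -> smooth_fun f -> smooth_fun (f \o F).
Proof.
move=> [cF sF] sf; apply: smooth_fun_local => p.
have [c Mc cp] := atlas_cover p; have [d Nd dp] := atlas_cover (F p).
pose O := F @^-1` dom d.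
have oO : open O by apply: open_comp_continuous => //; exact: dom_open.
have oW := @open_img _ _ _ c _ oO.
exists c, (coord c @` (dom c `&` O)); split=> //; first by exists p.
move=> k; have sFk := sF c d Mc Nd k.
apply: (Ck_ext oW _ (Ck_comp oW (@img_open _ _ _ d) _ sFk (sf d Nd k))).
  by move=> _ [q [cq dq] <-] /=; rewrite !coordK.
by move=> _ [q [cq dq] <-] /=; rewrite coordK//; exact: coord_img.
Qed.

Lemma smooth_map_comp l m n (L : manifold R l) (M : manifold R m)
    (N : manifold R n) (G : L -> M) (F : M -> N) :
  smooth_map G -> smooth_map F -> smooth_map (F \o G).
Proof.
move=> [cG sG] [cF sF]; split=> [x|c d Lc Nd k].
  by apply: continuous_comp; [exact: cG|exact: cF].
apply: Ck_local => _ [p [cp dp] <-].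
have [b Mb bp] := atlas_cover (G p).
pose O := dom c `&` G @^-1` (dom b `&` F @^-1` dom d).
have oO' : open (dom b `&` F @^-1` dom d).
  apply: openI; first exact: dom_open.
  by apply: open_comp_continuous => //; exact: dom_open.
have oO : open (G @^-1` (dom b `&` F @^-1` dom d)) by exact: open_comp_continuous.
have oW := @open_img _ _ _ c _ oO.
have oW' : open (coord b @` (dom b `&` F @^-1` dom d)).
  by apply: open_img; apply: open_comp_continuous => //; exact: dom_open.
exists (coord c @` (dom c `&` G @^-1` (dom b `&` F @^-1` dom d))); split=> //.
  by exists p.
have sGk : Ck k (coord c @` (dom c `&` G @^-1` (dom b `&` F @^-1` dom d)))
    (coord b \o G \o coordV c).
  apply: Ck_sub (sG c b Lc Mb k) => _ [q [cq [bq dq]] <-]; by exists q.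
apply: (Ck_ext oW _ (Ck_comp_row oW oW' _ sGk (sF b d Mb Nd k))).
  by move=> _ [q [cq [bq dq]] <-] /=; rewrite !coordK.
by move=> _ [q [cq [bq dq]] <-] /=; rewrite coordK//; exists (G q).
Qed.

Definition pullback m n (M : manifold R m) (N : manifold R n) (F : M -> N)
  (sF : smooth_map F) (f : Cinf N) : Cinf M :=
  mkCinf (smooth_fun_comp sF (@Cinf_mem _ _ _ f)).

End SmoothMaps.

Section Uniqueness.
Variables (R : realType) (n : nat) (M : manifold R n.+2) (omega : preform M n.+2).
Hypothesis omega_vol : volume_form omega.

Lemma fibration_vertical (N : manifold R n) (pi : M -> N) (Xi1 Xi2 : vector_field M)
    (f : Cinf N) (g : Cinf M) : fibration pi Xi1 Xi2 -> g =1 f \o pi ->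
  Xi1 g = 0 /\ Xi2 g = 0.
Proof.
move=> [_ _ _ _ tan] gE; split; apply: CinfP => x.
  have [_ vert] := tan x _ (vf_tangent Xi1 x); apply: vert gE.
  by exists 1, 0; apply/funext => h; rewrite mul1r mul0r addr0.
have [_ vert] := tan x _ (vf_tangent Xi2 x); apply: vert gE.
by exists 0, 1; apply/funext => h; rewrite mul1r mul0r add0r.
Qed.

Lemma related_unique m n' (M' : manifold R m) (N : manifold R n') (pi : M' -> N)
    (V V' : vector_field M') (D D' : vector_field N) :
  smooth_map pi -> (forall y, exists x, pi x = y) ->
  related pi V D -> related pi V' D' ->
  (forall (f : Cinf N) (g : Cinf M'), g =1 f \o pi -> V g = V' g) -> D = D'.
Proof.
move=> spi surj VD VD' VV; apply: vfP => f; apply: CinfP => y.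
have [x <-] := surj y; have E : pullback spi f =1 f \o pi by [].
have := VD f _ E x; rewrite (VV _ _ E) => VDx; exact: etrans (esym VDx) (VD' f _ E x).
Qed.

(** For two choices, the fields X1 -+ X2 differ by vertical fields, while lambda and the
    Xi_i mu_i coincide; equality descends to N because pi is onto. *)
Lemma associated_unique (N : manifold R n) (pi : M -> N) (P1 P2 : bivector M)
    (D D' : base_data N) :
  fibred_matching omega pi P1 P2 ->
  associated omega pi P1 P2 D -> associated omega pi P1 P2 D' -> D = D'.
Proof.
move=> [_ [Xi1 [Xi2 [mf1 mf2 ind Xi12 fib]]]].
have uniq1 Xi := fun m => modular_field_unique (Xi := Xi) omega_vol m mf1.
have uniq2 Xi := fun m => modular_field_unique (Xi := Xi) omega_vol m mf2.
case=> Y1 [Y2 [X1 [X2 [la [mu1 [mu2 [nu1 [nu2 [[/uniq1-> /uniq2->]]]]]]]]]] {Y1 Y2}.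
move=> [[P1E c1 _ _] [P2E c2 _ _]] str [rZ rW] [laE [nu1E nu2E] uE vE].
case=> Y1 [Y2 [X1' [X2' [la' [mu1' [mu2' [nu1' [nu2' [[/uniq1-> /uniq2->]]]]]]]]]] {Y1 Y2}.
move=> [[P1E' c1' _ _] [P2E' c2' _ _]] str' [rZ' rW'] [laE' [nu1E' nu2E'] uE' vE'].
have [n1 n2] := lin_indep_neq0 ind.
have [g1 X1E] := wedge_same_left n1 (etrans (esym P1E) P1E').
have [g2 X2E] := wedge_same_left n2 (etrans (esym P2E) P2E').
subst X1' X2'.
have [lala _ _] := gauge_cross ind Xi12 str str'.
have [la1 la2] := fibration_vertical fib laE.
have [nn1 nn2] := gauge_mu ind Xi12 c1 c2 str c1' c2' str' la1 la2.
have [spi surj _ _ _] := fib.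
have base_eq (f f' : Cinf N) : f \o pi =1 f' \o pi -> f = f'.
  by move=> ff; apply: CinfP => y; have [x <-] := surj y; exact: ff.
have nu11 : nu1 = nu1' by apply: base_eq => x; rewrite -nu1E -nu1E' nn1.
have nu22 : nu2 = nu2' by apply: base_eq => x; rewrite -nu2E -nu2E' nn2.
have zz : bd_z D = bd_z D' by apply: base_eq => x; rewrite -laE -laE' lala.
have ZZ : bd_Z D = bd_Z D'.
  apply: related_unique spi surj rZ rZ' _ => f g /(fibration_vertical fib)[v1 v2].
  by rewrite !(vfDE, vfNE, vfZE) v1 v2 !mulr0 !addr0.
have WW : bd_W D = bd_W D'.
  apply: related_unique spi surj rW rW' _ => f g /(fibration_vertical fib)[v1 v2].
  by rewrite !(vfDE, vfNE, vfZE) v1 v2 !mulr0 !addr0.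
case: D D' {rZ rZ' rW rW' laE laE'} uE vE uE' vE' zz ZZ WW => [Z W z u v] [Z' W' z' u' v'] /=.
by move=> -> -> -> -> -> -> ->; rewrite nu11 nu22.
Qed.

End Uniqueness.

(** * Functions constant on the fibres *)

Section FibrewiseConstant.
Variables (R : realType) (n : nat) (M : manifold R n.+2) (N : manifold R n).
Variables (pi : M -> N) (Xi1 Xi2 : vector_field M).
Hypothesis fib : fibration pi Xi1 Xi2.
Notation A := (Cinf M).

(** The first two coordinate directions of a submersion chart are vertical, hence are
    combinations of Xi1 and Xi2. *)
Lemma chart_partial_fibre (c : chart R (2 + n) M) (d : chart R n N) (i : 'I_2)
    (u : A) y :
  atlas M c -> atlas N d -> dom c `<=` pi @^-1` dom d ->
  (forall p, dom c p -> coord d (pi p) = rsubmx (coord c p)) ->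
  Xi1 u = 0 -> Xi2 u = 0 -> img c y -> chart_partial c (lshift n i) u y = 0.
Proof.
move=> Mc Nd cd piE u1 u2 yc; have cq := coordV_dom yc; set q := coordV c y in cq.
have yq : y = coord c q by rewrite /q coordVK.
have [_ _ _ _ tan] := fib.
have [vert _] := tan q _ (chart_partial_tangent (lshift n i) Mc cq).
have [|a [b vE]] := vert; last first.
  have := congr1 (fun v : A -> R => v u) vE; rewrite -yq => ->.
  by rewrite u1 u2 Cinf0E !mulr0 addr0.
move=> f g gE; rewrite -yq /chart_partial.
pose K (z : 'rV[R]_(2 + n)) : R^o := f (coordV d (rsubmx z)).
have : \forall z \near y, (g \o coordV c : _ -> R^o) z = K z.
  have : nbhs y (img c) by apply: open_nbhs_nbhs; split=> //; exact: img_open.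
  apply: filterS => z zc; have cz := coordV_dom zc.
  rewrite /= gE /= /K -[in RHS](coordVK zc) -piE// coordK//; exact: cd.
move=> /near_eq_derive ->; rewrite /derive.
rewrite (_ : (fun h => _) = cst 0) ?lim_cst//; apply/funext => h /=.
rewrite /K (_ : rsubmx (_ + _) = rsubmx y) ?subrr ?scaler0//.
apply/rowP => j; rewrite !mxE eqxx /=.
by rewrite -[X in X == _]/(rshift 2 j) eq_rlshift mulr0 add0r.
Qed.

(** The leafwise partial derivatives of u vanish in a submersion chart, so u is constant
    along segments of a ball that run inside a fibre.  The fibre itself may meet
    the chart in a disconnected set, hence the neighbourhood O. *)
Lemma fibre_locally_constant (u : A) x : Xi1 u = 0 -> Xi2 u = 0 ->
  exists O : set M, [/\ open O, O x & forall x', O x' -> pi x' = pi x -> u x' = u x].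
Proof.
move=> u1 u2; have [_ _ sub _ _] := fib.
have [c [d [Mc Nd cx cd piE]]] := sub x.
have yc := coord_img cx; set y0 := coord c x in yc.
have nW : nbhs y0 (img c) by apply: open_nbhs_nbhs; split=> //; exact: img_open.
have [r /= r0 rW] := (nbhs_ballP _ _).1 nW.
exists (dom c `&` coord c @^-1` ball y0 r); split.
- exact: (@open_preimage _ _ _ c _ (ball_open y0 r)).
- by split=> //; exact: ballxx.
move=> x' [cx' bx'] pix; set y' := coord c x' in bx'.
pose ut : 'rV[R]_(2 + n) -> R^o := u \o coordV c.
have uE z : dom c z -> u z = ut (coord c z) by move=> cz; rewrite /ut /= coordK.
have rr : rsubmx y' = rsubmx y0 :> 'rV[R]_n by rewrite -!piE// pix.
pose w := y' - y0.
have dut z : ball y0 r z -> differentiable ut z.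
  by move=> /rW zc; have [dd _] := Cinf_mem u Mc 1%N; exact: dd.
have Dw z : ball y0 r z -> 'D_w ut z = 0.
  move=> bz; rewrite derive_row; last exact: dut.
  rewrite big1// => i _; case: (split_ordP i) => j ->.
    have -> : 'D_(delta_mx 0 (lshift n j)) ut z = 0.
      exact: (chart_partial_fibre (u := u) j Mc Nd cd piE u1 u2 (rW _ bz)).
    by rewrite scaler0.
  have -> : w 0 (rshift 2 j) = 0; last by rewrite scale0r.
  have := congr1 (fun m : 'rV[R]_n => m 0 j) rr; rewrite !mxE => E.
  by rewrite E subrr.
have seg (t : R) : 0 <= t <= 1 -> ball y0 r (t *: w + y0).
  by move=> t01; rewrite addrC; exact: (segment_point_ball t01 bx').
pose g (t : R) : R := ut (t *: w + y0).
have dg (t : R) : 0 <= t <= 1 -> is_derive t (1 : R) g 0.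
  move=> t01; rewrite -(Dw _ (seg t t01)); apply: derivable_line.
  by apply: dut; exact: seg.
have [||t _ gD] := @MVT_segment R g (fun=> 0) 0 1 ler01.
- by move=> t; rewrite in_itv/= => /andP[/ltW t0 /ltW t1]; apply: dg; rewrite t0.
- apply: continuous_in_subspaceT => t; rewrite inE/= in_itv/= => t01.
  by apply/differentiable_continuous/derivable1_diffP; case: (dg t t01).
move: gD; rewrite mul0r => /subr0_eq; rewrite /g scale1r scale0r add0r subrK.
by rewrite !uE.
Qed.

Lemma fibre_constant (u : A) x x' : Xi1 u = 0 -> Xi2 u = 0 -> pi x' = pi x ->
  u x' = u x.
Proof.
move=> u1 u2 pix; have [_ _ _ conn _] := fib.
have /choice[ngb OP] := fun x => @fibre_locally_constant u x u1 u2.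
pose F := pi @^-1` [set pi x].
suff E : F `&` [set z | u z = u x] = F.
  by have : F x' by []; rewrite -E => -[].
apply: (conn (pi x)).
- by exists x.
- exists (\bigcup_(z in F `&` [set z | u z = u x]) ngb z).
    by apply: bigcup_open => z _; have [] := OP z.
  apply/seteqP; split=> [z [Fz uz]|z [Fz [z' [Fz' uz'] Oz]]].
    by split=> //; exists z => //; have [] := OP z.
  split=> //=; have [_ _ Oc] := OP z'; rewrite (Oc z Oz) //.
  by rewrite (Fz : pi z = pi x) (Fz' : pi z' = pi x).
- exists [set z | u z = u x] => //.
  apply: (closed_comp (f := u) (D := [set u x])) => [z _|].
    exact: Cinf_continuous.
  exact: closed_eq.
Qed.

End FibrewiseConstant.

(** * The map induced on the base *)

Section InducedMap.
Variables (R : realType) (n n' : nat) (M : manifold R n.+2) (N : manifold R n).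
Variables (N' : manifold R n') (pi : M -> N) (Xi1 Xi2 : vector_field M).
Hypothesis fib : fibration pi Xi1 Xi2.

(** A local section through x, given in charts as insertion of the coordinates of the
    base with the two fibre coordinates of x held fixed. *)
Lemma local_section (x : M) : exists (c : chart R (2 + n) M) (d : chart R n N)
    (j : 'rV[R]_n -> 'rV[R]_(2 + n)) (V : set N),
  [/\ atlas M c, atlas N d, (forall k, Ck k setT j), open V & V (pi x)] /\
  forall y, V y -> [/\ dom d y, img c (j (coord d y)) &
    pi (coordV c (j (coord d y))) = y].
Proof.
have [_ _ sub _ _] := fib; have [c [d [Mc Nd cx cd piE]]] := sub x.
pose j (z : 'rV[R]_n) : 'rV[R]_(2 + n) := row_mx (lsubmx (coord c x)) z.
have sj k : Ck k setT j.
  apply/(Ck_rowP _ _ openT) => i; case: (split_ordP i) => i' ->.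
    by apply: Ck_ext openT _ (Ck_cst k _ (coord c x 0 (lshift n i'))) => z _;
       rewrite /j row_mxEl mxE.
  by apply: Ck_ext openT _ (Ck_coord k i' openT) => z _; rewrite /j row_mxEr.
have cj : continuous j by move=> z; exact: (sj 0%N z I).
exists c, d, j, (dom d `&` coord d @^-1` (j @^-1` img c)).
split; first split=> //.
- apply: (@open_preimage _ _ _ d _ _); apply: open_comp_continuous => //.
  exact: img_open.
- split; first exact: cd.
  by rewrite /= piE// /j hsubmxK; exact: coord_img.
move=> y [dy jy]; split=> //.
have cy := coordV_dom jy.
by rewrite -[RHS](coordK dy) -[LHS](coordK (cd _ cy)) piE// coordVK// /j row_mxKr.
Qed.

(** Near any point psi is h composed with a local section of pi, which gives its
    continuity and smoothness. *)
Lemma induced_map (h : M -> N') (sh : smooth_map h) :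
  (forall f : Cinf N', Xi1 (pullback sh f) = 0 /\ Xi2 (pullback sh f) = 0) ->
  exists2 psi : N -> N', smooth_map psi & psi \o pi = h.
Proof.
move=> hf; have [_ surj _ _ _] := fib.
have hE x x' : pi x' = pi x -> h x' = h x.
  move=> pix; apply: smooth_fun_separates => f; have [f1 f2] := hf f.
  exact: (fibre_constant fib (u := pullback sh f) f1 f2 pix).
have /choice[s sE] := surj.
pose psi y := h (s y).
have psiE y x : pi x = y -> psi y = h x by move=> xy; apply: hE; rewrite sE.
have [ch sch] := sh.
have cpsi : continuous psi.
  move=> y; have [x xy] := surj y.
  have [c [d [j [V [[Mc Nd sj oV Vx] VP]]]]] := local_section x.
  rewrite xy in Vx; have [dy jy piy] := VP y Vx.
  have cj : continuous j by move=> z; exact: (sj 0%N z I).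
  have cc : {for y, continuous (h \o (coordV c \o (j \o coord d)))}.
    apply: continuous_comp; last exact: ch.
    apply: continuous_comp; last exact: coordV_cont.
    by apply: continuous_comp; [exact: coord_cont|exact: cj].
  have ne : {near y, h \o (coordV c \o (j \o coord d)) =1 psi}.
    have : nbhs y V by apply: open_nbhs_nbhs.
    by apply: filterS => z /VP[_ _ /psiE ->].
  rewrite /continuous_at -(nbhs_singleton ne).
  by apply: cvg_trans cc; apply: near_eq_cvg.
exists psi; last by apply/funext => x /=; exact: psiE.
split=> // b e Nb N'e k; apply: Ck_local => _ [y [by_ ey] <-].
have [x xy] := surj y.
have [c [d [j [V [[Mc Nd sj oV Vx] VP]]]]] := local_section x.
rewrite xy in Vx.
pose Q := V `&` psi @^-1` dom e.
have oQ : open Q.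
  by apply: openI => //; apply: open_comp_continuous => //; exact: dom_open.
have oW := @open_img _ _ _ b _ oQ.
exists (coord b @` (dom b `&` Q)); split=> //; first by exists y.
pose W := coord b @` (dom b `&` Q).
have sbd : Ck k W (coord d \o coordV b).
  apply: Ck_sub (atlas_compat Nb Nd k) => _ [z [bz [Vz _]] <-].
  by have [dz _ _] := VP z Vz; exists z.
have sjbd : Ck k W (j \o (coord d \o coordV b)).
  exact: (Ck_comp_row oW openT (fun _ _ => I) sbd (sj k)).
have oh : open (coord c @` (dom c `&` h @^-1` dom e)).
  by apply: open_img; apply: open_comp_continuous => //; exact: dom_open.
apply: (Ck_ext oW _ (Ck_comp_row oW oh _ sjbd (sch c e Mc N'e k))).
  move=> _ [z [bz [/VP[dz jz piz] ez]] <-] /=; rewrite coordK//.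
  by rewrite (psiE z _ piz).
move=> _ [z [bz [/VP[dz jz piz] ez]] <-] /=; rewrite coordK//.
exists (coordV c (j (coord d z))); last by rewrite coordVK.
by split; [exact: coordV_dom|rewrite /= -(psiE z _ piz)].
Qed.

End InducedMap.

(** * Push-forward along a diffeomorphism *)

Section PushForward.
Variables (R : realType) (m n : nat) (M : manifold R m) (N : manifold R n).
Variables (F : M -> N) (G : N -> M) (sF : smooth_map F) (sG : smooth_map G).
Hypotheses (FK : cancel F G) (GK : cancel G F).
Implicit Types (X Y : vector_field M) (f g : Cinf M).

Definition push_fun f : Cinf N := pullback sG f.

Lemma push_funE f p : push_fun f p = f (G p). Proof. by []. Qed.
Lemma pullbackE (f : Cinf N) p : pullback sF f p = f (F p). Proof. by []. Qed.

Lemma push_funK : cancel push_fun (pullback sF).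
Proof. by move=> f; apply: CinfP => p /=; rewrite FK. Qed.

Lemma pullbackK : cancel (pullback sF) push_fun.
Proof. by move=> f; apply: CinfP => p /=; rewrite GK. Qed.

Lemma push_derivation X : derivation (fun f : Cinf N => push_fun (X (pullback sF f))).
Proof.
split=> [a f g|f g].
  rewrite (_ : pullback sF _ = a *: pullback sF f + pullback sF g); last exact: CinfP.
  by rewrite (vf_derivation X).1; exact: CinfP.
rewrite (_ : pullback sF _ = pullback sF f * pullback sF g); last exact: CinfP.
rewrite (vf_derivation X).2; apply: CinfP => p.
by rewrite push_funE !(CinfDE, CinfME) !push_funE !pullbackE GK.
Qed.

Definition push X : vector_field N := VectorField (push_derivation X).

Lemma push_apply X f : push X (push_fun f) = push_fun (X f).
Proof. by rewrite /= push_funK. Qed.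

(** Equality of fields on N may be tested on functions transported from M, on which
    [push X] is computed by [push_apply]. *)
Lemma push_ext (V W : vector_field N) :
  (forall f, V (push_fun f) = W (push_fun f)) -> V = W.
Proof. by move=> VW; apply: vfP => f; rewrite -(pullbackK f). Qed.

Lemma pushD X Y : push (X + Y) = push X + push Y.
Proof. by apply: push_ext => f; rewrite vfDE !push_apply; exact: CinfP. Qed.
Lemma pushN X : push (- X) = - push X.
Proof. by apply: push_ext => f; rewrite vfNE !push_apply; exact: CinfP. Qed.
Lemma push0 : push 0 = 0.
Proof. by apply: push_ext => f; rewrite push_apply; exact: CinfP. Qed.
Lemma pushZ g X : push (g *: X) = push_fun g *: push X.
Proof. by apply: push_ext => f; rewrite vfZE !push_apply; exact: CinfP. Qed.
Lemma push_lie X Y : push (lie X Y) = lie (push X) (push Y).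
Proof. by apply: push_ext => f; rewrite lieE !push_apply; exact: CinfP. Qed.

Lemma push_related X : related F X (push X).
Proof.
move=> f g gE x; rewrite /= FK; congr (X _ x); exact: CinfP.
Qed.

End PushForward.

(** * Naturality of modular data *)

Section Naturality.
Variables (R : realType) (m : nat) (M : manifold R m).
Variables (F G : M -> M) (sF : smooth_map F) (sG : smooth_map G).
Hypotheses (FK : cancel F G) (GK : cancel G F).
Notation pushv := (push sF sG GK).
Notation pushf := (push_fun sG).
Notation VF := (vector_field M).

Lemma push_fun_sum (I : Type) (r : seq I) (P : pred I) (f : I -> Cinf M) :
  pushf (\sum_(i <- r | P i) f i) = \sum_(i <- r | P i) pushf (f i).
Proof. by apply: CinfP => p; rewrite push_funE !Cinf_sumE. Qed.

Lemma push_fun_sign k (f : Cinf M) : pushf ((-1) ^+ k * f) = (-1) ^+ k * pushf f.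
Proof.
rewrite -signr_odd; case: (odd k); last by rewrite !mul1r.
by rewrite !mulN1r; exact: CinfP.
Qed.

Lemma push_surj (Y : VF) : exists X, pushv X = Y.
Proof.
exists (push sG sF FK Y); apply: (push_ext sF GK) => f.
rewrite (push_apply sF sG FK GK).
by apply: CinfP => p; rewrite push_funE -[in RHS](GK p).
Qed.

Lemma push_family k (Y : 'I_k -> VF) : exists X : 'I_k -> VF, Y = pushv \o X.
Proof.
have /choice[X XE] := fun i => push_surj (Y i).
by exists X; apply/funext => i; rewrite /= XE.
Qed.

(** Forms being defined on families of global fields, F-naturality is expressed by
    pushing such families forward; every family arises in this way. *)
Definition pushes_form k (alpha beta : preform M k) : Prop :=
  forall Y, beta (pushv \o Y) = pushf (alpha Y).

Lemma pushes_form_fun k (alpha beta beta' : preform M k) :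
  pushes_form alpha beta -> pushes_form alpha beta' -> beta = beta'.
Proof.
by move=> ab ab'; apply/funext => Y; have [X ->] := push_family Y; rewrite ab ab'.
Qed.

Lemma pushes_iprod k (alpha beta : preform M k.+1) X :
  pushes_form alpha beta -> pushes_form (iprod X alpha) (iprod (pushv X) beta).
Proof.
move=> ab Y; rewrite /iprod -ab; congr beta; apply/funext => i.
by rewrite /fcons /=; case: unlift.
Qed.

Lemma pushes_ext_d k (alpha beta : preform M k) :
  pushes_form alpha beta -> pushes_form (ext_d alpha) (ext_d beta).
Proof.
move=> ab Y; rewrite /ext_d (_ : pushf (_ + _) = pushf (\sum_(i < k.+1) (-1) ^+ i *
    Y i (alpha (Y \o lift i))) + pushf (\sum_(i < k.+1) \sum_(j < k.+1 | (i < j)%N)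
      (-1) ^+ (i + j) * alpha (fun l => if l == 0 :> nat then lie (Y i) (Y j)
                      else Y (inord (bump j (bump i l.-1)))))); last exact: CinfP.
rewrite !push_fun_sum; congr (_ + _).
  apply: eq_bigr => i _; rewrite push_fun_sign -(push_apply sF sG FK GK) -ab.
  by [].
apply: eq_bigr => i _; rewrite push_fun_sum; apply: eq_bigr => j _.
rewrite push_fun_sign -ab; congr (_ * beta _); apply/funext => l /=.
by case: ifP => // _; rewrite (push_lie sF sG FK GK).
Qed.

Lemma pushes_lie_derivative k (alpha beta : preform M k) X :
  pushes_form alpha beta ->
  pushes_form (lie_derivative X alpha) (lie_derivative (pushv X) beta).
Proof.
move=> ab Y; rewrite /lie_derivative ab (push_apply sF sG FK GK).
rewrite [RHS](_ : _ = pushf (X (alpha Y)) - pushf (\sum_(i < k)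
  alpha [eta Y with i |-> lie X (Y i)])); last exact: CinfP.
congr (_ - _); rewrite push_fun_sum; apply: eq_bigr => i _; rewrite -ab.
congr beta; apply/funext => l /=; case: eqP => // _.
by rewrite (push_lie sF sG FK GK).
Qed.

Lemma pushes_preserved k (omega : preform M k) :
  preserves_form F omega -> pushes_form omega omega.
Proof.
move=> pres Y; apply: CinfP => p; rewrite push_funE.
have := pres Y (pushv \o Y) (fun i => push_related sF sG FK GK (Y i)) (G p).
by rewrite /= GK => ->.
Qed.

Lemma push_wedge (P P' : bivector M) X Y : carries_bivector F P P' ->
  P = wedge X Y -> P' = wedge (pushv X) (pushv Y).
Proof.
move=> carr PE; apply/funext => f; apply/funext => g; apply: CinfP => p.
have := carr (pullback sF f) (pullback sF g) f g
  (fun _ => erefl) (fun _ => erefl) (G p).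
by rewrite PE /= GK => <-.
Qed.

End Naturality.

Section MatchingNaturality.
Variables (R : realType) (n : nat) (M : manifold R n.+2) (omega : preform M n.+2).
Variables (F G : M -> M) (sF : smooth_map F) (sG : smooth_map G).
Hypotheses (FK : cancel F G) (GK : cancel G F).
Hypothesis F_omega : preserves_form F omega.
Notation pushv := (push sF sG GK).
Notation pushf := (push_fun sG).

Let omega_push : pushes_form sF sG GK omega omega :=
  pushes_preserved sF sG FK GK F_omega.

Lemma push_modular_field (P P' : bivector M) Xi : carries_bivector F P P' ->
  modular_field omega P Xi -> modular_field omega P' (pushv Xi).
Proof.
move=> carr [X [Y [PE dE]]]; exists (pushv X), (pushv Y); split.
  exact: (push_wedge sF sG GK carr PE).
have H1 := pushes_iprod Xi omega_push.
have H2 := pushes_ext_d FK (pushes_iprod X (pushes_iprod Y omega_push)).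
by rewrite dE in H1; exact: (pushes_form_fun FK H1 H2).
Qed.

Lemma push_modular_presentation (P P' : bivector M) X Xi : carries_bivector F P P' ->
  modular_presentation omega P X Xi ->
  modular_presentation omega P' (pushv X) (pushv Xi).
Proof.
move=> carr [PE XXi LXi LX]; split.
- exact: (push_wedge sF sG GK carr PE).
- by rewrite -(push_lie sF sG FK GK) XXi (push0 sF sG FK GK).
- have H := pushes_lie_derivative FK Xi omega_push; rewrite LXi in H.
  by apply: (pushes_form_fun FK H) => Y; exact: CinfP.
- have H := pushes_lie_derivative FK X omega_push; rewrite LX in H.
  exact: (pushes_form_fun FK H omega_push).
Qed.

Lemma push_structure_equations X1 Xi1 X2 Xi2 lambda mu1 mu2 :
  structure_equations X1 Xi1 X2 Xi2 0 0 lambda mu1 mu2 ->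
  structure_equations (pushv X1) (pushv Xi1) (pushv X2) (pushv Xi2) 0 0
    (pushf lambda) (pushf mu1) (pushf mu2).
Proof.
move=> [E1 E2 E3]; split; rewrite -(push_lie sF sG FK GK) ?E1 ?E2 ?E3.
- by rewrite !scale0r !add0r (pushZ sF sG FK GK).
- by rewrite !scale0r !addr0 (pushZ sF sG FK GK).
- by rewrite !(pushD sF sG FK GK, pushN sF sG FK GK, pushZ sF sG FK GK).
Qed.

End MatchingNaturality.

(** * Transport of the base data *)

Section Transport.
Variables (R : realType) (n : nat) (M : manifold R n.+2) (omega : preform M n.+2).
Variables (N N' : manifold R n) (pi : M -> N) (pi' : M -> N').
Variables (F G : M -> M) (sF : smooth_map F) (sG : smooth_map G).
Hypotheses (FK : cancel F G) (GK : cancel G F).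
Variables (psi : N -> N') (chi : N' -> N).
Variables (spsi : smooth_map psi) (schi : smooth_map chi).
Hypotheses (psiK : cancel psi chi) (chiK : cancel chi psi).
Hypothesis psi_pi : psi \o pi = pi' \o F.

Let pi_G y : pi (G y) = chi (pi' y).
Proof. by rewrite -[LHS]psiK -[psi _]/((psi \o pi) _) psi_pi /= GK. Qed.

Lemma push_base_fun (f : Cinf N) (g : Cinf M) : g =1 f \o pi ->
  push_fun sG g =1 push_fun schi f \o pi'.
Proof. by move=> gE y; rewrite push_funE gE /= pi_G. Qed.

Lemma push_base_related (V : vector_field M) (W : vector_field N) :
  related pi V W -> related pi' (push sF sG GK V) (push spsi schi chiK W).
Proof.
move=> VW f g gE y.
have E : pullback sF g =1 pullback spsi f \o pi.
  by move=> x; rewrite /= gE /= -[psi (pi x)]/((psi \o pi) x) psi_pi.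
by have := VW _ _ E (G y); rewrite /= pi_G.
Qed.

Definition push_data (D : base_data N) : base_data N' :=
  BaseData (push spsi schi chiK (bd_Z D)) (push spsi schi chiK (bd_W D))
    (push_fun schi (bd_z D)) (push_fun schi (bd_u D)) (push_fun schi (bd_v D)).

Lemma push_data_carries (D : base_data N) : carries_data psi D (push_data D).
Proof.
split; first exact: push_related.
- exact: push_related.
- by move=> x; rewrite /= psiK.
- by move=> x; rewrite /= psiK.
- by move=> x; rewrite /= psiK.
Qed.

(** Each ingredient of the construction of the data is natural, so the pushed fields and
    functions witness the claim. *)
Lemma push_associated (P1 P2 P1' P2' : bivector M) (D : base_data N) :
  preserves_form F omega -> carries_bivector F P1 P1' -> carries_bivector F P2 P2' ->
  associated omega pi P1 P2 D -> associated omega pi' P1' P2' (push_data D).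
Proof.
move=> F_omega c1 c2.
case=> Xi1 [Xi2 [X1 [X2 [la [mu1 [mu2 [nu1 [nu2]]]]]]]].
move=> [[mf1 mf2] [mp1 mp2] str [rZ rW] [laE [nu1E nu2E] uE vE]].
pose p := push sF sG GK.
exists (p Xi1), (p Xi2), (p X1), (p X2), (push_fun sG la), (push_fun sG mu1),
  (push_fun sG mu2), (push_fun schi nu1), (push_fun schi nu2).
split.
- by split; [exact: push_modular_field c1 mf1|exact: push_modular_field c2 mf2].
- by split; [exact: push_modular_presentation c1 mp1|
             exact: push_modular_presentation c2 mp2].
- exact: push_structure_equations.
- rewrite /p -(pushN sF sG FK GK) -!(pushD sF sG FK GK).
  by split; exact: push_base_related.
split; first exact: push_base_fun.
- by rewrite /p !(push_apply sF sG FK GK); split; exact: push_base_fun.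
- by rewrite /= uE; exact: CinfP.
- by rewrite /= vE; exact: CinfP.
Qed.

End Transport.

Theorem proposition3p13 (R : realType) (n : nat) (M : manifold R n.+2)
    (omega : preform M n.+2) (omega_vol : volume_form omega) :
  (forall (N : manifold R n) (pi : M -> N) (P1 P2 : bivector M)
          (D D' : base_data N),
     fibred_matching omega pi P1 P2 ->
     associated omega pi P1 P2 D -> associated omega pi P1 P2 D' -> D = D')
  /\
  (forall (phi : M -> M) (P1 P2 P1' P2' : bivector M)
          (N N' : manifold R n) (pi : M -> N) (pi' : M -> N'),
     diffeomorphism phi -> preserves_form phi omega ->
     fibred_matching omega pi P1 P2 -> fibred_matching omega pi' P1' P2' ->
     carries_bivector phi P1 P1' -> carries_bivector phi P2 P2' ->
     exists psi : N -> N',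
       [/\ diffeomorphism psi, psi \o pi = pi' \o phi &
           forall (D : base_data N) (D' : base_data N'),
             associated omega pi P1 P2 D -> associated omega pi' P1' P2' D' ->
             carries_data psi D D']).
Proof.
split=> [N pi P1 P2 D D'|]; first exact: associated_unique.
move=> phi P1 P2 P1' P2' N N' pi pi' [sphi [G [sG phiK GK]]] pres fm fm' c1 c2.
have [_ [Xi1 [Xi2 [mf1 mf2 _ _ fib]]]] := fm.
have [_ [Xi1' [Xi2' [mf1' mf2' _ _ fib']]]] := fm'.
pose p := push sphi sG GK.
have pXi1 : p Xi1 = Xi1'.
  have mf := push_modular_field sphi sG phiK GK pres c1 mf1.
  exact: modular_field_unique omega_vol mf mf1'.
have pXi2 : p Xi2 = Xi2'.
  have mf := push_modular_field sphi sG phiK GK pres c2 mf2.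
  exact: modular_field_unique omega_vol mf mf2'.
subst Xi1' Xi2'.
have [spi surj _ _ _] := fib; have [spi' surj' _ _ _] := fib'.
have [psi spsi psiE] : exists2 psi : N -> N', smooth_map psi & psi \o pi = pi' \o phi.
  apply: (induced_map fib (sh := smooth_map_comp sphi spi')) => f.
  have [v1 v2] := fibration_vertical fib' (g := pullback spi' f) (fun _ => erefl).
  have kill (Xi : vector_field M) : p Xi (pullback spi' f) = 0 ->
      Xi (pullback (smooth_map_comp sphi spi') f) = 0.
    move=> v; apply: CinfP => x.
    have := congr1 (fun h : Cinf M => h (phi x)) v; rewrite /= phiK.
    by apply: etrans; congr (Xi _ x); exact: CinfP.
  by split; exact: kill.
have [chi schi chiE] : exists2 chi : N' -> N, smooth_map chi & chi \o pi' = pi \o G.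
  apply: (induced_map fib' (sh := smooth_map_comp sG spi)) => f.
  have [v1 v2] := fibration_vertical fib (g := pullback spi f) (fun _ => erefl).
  have kill (Xi : vector_field M) : Xi (pullback spi f) = 0 ->
      p Xi (pullback (smooth_map_comp sG spi) f) = 0.
    move=> v; rewrite (_ : pullback _ f = push_fun sG (pullback spi f)).
      by rewrite /p (push_apply sphi sG phiK GK) v; exact: CinfP.
    exact: CinfP.
  by split; exact: kill.
have psiK : cancel psi chi.
  move=> y; have [x <-] := surj y.
  by rewrite -[psi _]/((psi \o pi) x) psiE /= -[chi _]/((chi \o pi') _) chiE /= phiK.
have chiK : cancel chi psi.
  move=> y; have [x <-] := surj' y.
  by rewrite -[chi _]/((chi \o pi') x) chiE /= -[psi _]/((psi \o pi) _) psiE /= GK.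
exists psi; split=> //; first by split=> //; exists chi.
move=> D D' aD aD'.
have aD'' := push_associated sphi sG phiK GK spsi schi psiK chiK psiE pres c1 c2 aD.
by rewrite -(associated_unique omega_vol fm' aD'' aD'); exact: push_data_carries.
Qed.
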